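(* Let $K\subseteq\mathbb R^d$ be an origin-symmetric convex body and let $T=\{x\in\mathbb R^d:\ |\langle x,u\rangle|\le 1\}$ be a symmetric slab, where $u\in\mathbb R^d$. Then \[ \gamma_d(\mathrm{conv}\{K\cup T\})\,\gamma_d(K\cap T)\;\ge\;\gamma_d(K)\,\gamma_d(T). \]
   Context: $\gamma_d$ denotes the standard Gaussian probability measure on $\mathbb R^d$, with density proportional to $e^{-\|x\|^2/2}$. $\mathrm{conv}\{S\}$ is the convex hull of $S$. A set $K$ is origin-symmetric if $K=-K$. *)

(* Defs.v *)
From HB Require Import structures.
From mathcomp Require Import all_boot all_order all_algebra.
From mathcomp Require Import all_classical all_reals all_analysis.
Set Implicit Arguments. Unset Strict Implicit. Unset Printing Implicit Defensive.
Import Order.TTheory GRing.Theory Num.Theory.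
Import numFieldNormedType.Exports.
Local Open Scope classical_set_scope.
Local Open Scope ring_scope.

Definition dotp {R : realType} {d : nat} (x y : 'rV[R]_d) : R :=
  \sum_(i < d) x ord0 i * y ord0 i.

Definition is_convex {R : realType} {d : nat} (A : set 'rV[R]_d) : Prop :=
  forall x y t, A x -> A y -> 0 <= t <= 1 -> A (t *: x + (1 - t) *: y).

Definition convex_body {R : realType} {d : nat} (K : set 'rV[R]_d) : Prop :=
  is_convex K /\ compact K /\ (K°) !=set0.

Definition origin_symmetric {R : realType} {d : nat} (K : set 'rV[R]_d) : Prop :=
  K = [set - x | x in K].

Definition conv_hull {R : realType} {d : nat} (S : set 'rV[R]_d) : set 'rV[R]_d :=
  \bigcap_(C in [set C : set 'rV[R]_d | is_convex C /\ S `<=` C]) C.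

Definition slab {R : realType} {d : nat} (u : 'rV[R]_d) : set 'rV[R]_d :=
  [set x | `|dotp x u| <= 1].

Fixpoint gauss_iter {R : realType} (n : nat) (g : seq R -> \bar R) : \bar R :=
  match n with
  | 0 => g [::]
  | n'.+1 => (\int[normal_prob (0:R) 1]_x gauss_iter n' (fun s => g (x :: s)))%E
  end.

(* Standard Gaussian measure γ_d on R^d = product of d standard normals
   (evaluated by Tonelli as an iterated integral of the indicator). *)
Definition gaussian_measure {R : realType} (d : nat) (A : set 'rV[R]_d) : \bar R :=
  gauss_iter d (fun s => ((\1_A (\row_(i < d) nth 0 s i) : R))%:E).

(* Main.v *)
Require Import Defs.
From HB Require Import structures.
From mathcomp Require Import all_boot all_order all_algebra.
From mathcomp Require Import all_classical all_reals all_analysis.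
From mathcomp Require Import measurable_realfun.
From mathcomp Require Import ring lra.
Import Order.TTheory GRing.Theory Num.Theory.
Import numFieldNormedType.Exports.
Local Open Scope classical_set_scope.
Local Open Scope ring_scope.

(** If [K] lies in the slab [T], then [K] and [T] meet in [K] and monotonicity suffices.
    Otherwise let [h = max_K |<x, u>| > 1]; the convex hull of [K] and [T] contains the open slab
    [|<x, u>| < h], while [K] lies in its closure. Disintegrating the Gaussian measure along
    [u], let [f t] be the Gaussian measure of the slice of [K] at height [t]: it is even
    and, by Prekopa-Leindler, log-concave, so it decreases in [|t|]. Hence its average over
    the inner window [|<x, u>| <= 1] is at least its average over the outer window
    [|<x, u>| < h], which is the inequality.
    The slices are obtained without changing coordinates in the whole space: a direction
    [(a, u')] is handled by first disintegrating along [u'] and then rotating a single plane,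
    a rotation being a product of three shears. *)

(** * Integration against Lebesgue and Gaussian measure *)

(** The iterated integral behind [gaussian_measure] comes without rotation invariance in dimension
    [d], so the height along [u] cannot simply be made a coordinate. The slice function is built by
    induction on the coordinates instead, as an operator [E] on functions of sequences, and the
    fields of [disintegration] are what this induction has to carry. Log-concavity is carried for
    three functions at once, because slicing one function at two heights and at their mean gives
    three different functions. Measurability is carried for parametrised families, because a slice
    depends on variables that are integrated later. On the line, only functions whose superlevel
    sets are intervals occur, so Brunn-Minkowski reduces to comparing lengths. The hull is only
    known to contain the open slab, so the part of [K] at height exactly [h] has to be shown
    negligible. Since [E] is tied to the measure by integrals and not pointwise, this too goes
    through an integral identity. *)

Section nonneg_integral.
Local Open Scope ereal_scope.
Context d (T : measurableType d) (R : realType) (mu : {measure set T -> \bar R}).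

Import HBNNSimple.

(** The integral of a nonnegative function is a supremum over the simple functions below it, hence
    monotone for arbitrary functions. This covers the indicator of the convex hull, whose
    measurability is never established. *)
Lemma ge0_le_integral_nomeas (f g : T -> \bar R) :
  (forall x, 0 <= f x) -> (forall x, f x <= g x) ->
  \int[mu]_x f x <= \int[mu]_x g x.
Proof.
move=> f0 fg.
rewrite !ge0_integralTE//; last by move=> x; exact: le_trans (fg x).
apply: le_ereal_sup => _ [h hf <-]; exists h => // x; exact: le_trans (fg x).
Qed.

End nonneg_integral.

Section lebesgue_invariance.
Local Open Scope ereal_scope.
Context {R : realType}.
Local Notation mu := (@lebesgue_measure R).

Lemma lebesgue_measureD (a : R) (A : set R) : measurable A ->
  pushforward mu (fun x : measurableTypeR R => (x + a)%R : measurableTypeR R) A = mu A.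
Proof.
move=> mA.
have mf : measurable_fun setT (fun x : measurableTypeR R => (x + a)%R : measurableTypeR R).
  exact: measurable_funD.
pose f : {mfun measurableTypeR R >-> measurableTypeR R} :=
  HB.pack (fun x : measurableTypeR R => (x + a)%R : measurableTypeR R)
   (isMeasurableFun.Build _ _ _ _ _ mf).
apply/esym/(@lebesgue_measure_unique _ (pushforward mu f)) => //= _ [[b c]] _ <-.
rewrite /pushforward.
have -> : f @^-1` `]b, c] = `](b - a)%R, (c - a)%R]%classic.
  by apply/seteqP; split => x /=; rewrite !in_itv/= ltrBlDr lerBrDr.
rewrite !lebesgue_measure_itv/= !lte_fin ltrD2r.
by case: ifP => // _; rewrite -!EFinB; congr EFin; ring.
Qed.

Lemma ge0_integral_shift (a : R) (f : R -> \bar R) :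
  measurable_fun setT f -> (forall x, 0 <= f x) ->
  \int[mu]_x f (x + a)%R = \int[mu]_x f x.
Proof.
move=> mf f0.
have mp : measurable_fun setT (fun x : measurableTypeR R => (x + a)%R : measurableTypeR R).
  exact: measurable_funD.
transitivity (\int[pushforward mu (fun x : measurableTypeR R => (x + a)%R : measurableTypeR R)]_x f x).
  by rewrite ge0_integral_pushforward.
by apply: eq_measure_integral => A mA _; exact: lebesgue_measureD.
Qed.

Lemma ge0_integral_opp (f : R -> \bar R) :
  measurable_fun setT f -> (forall x, 0 <= f x) ->
  \int[mu]_x f (- x)%R = \int[mu]_x f x.
Proof.
move=> mf f0.
have mp : measurable_fun setT (-%R : _ -> measurableTypeR R) by [].
transitivity (\int[pushforward mu (-%R : _ -> measurableTypeR R)]_x f x).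
  by rewrite ge0_integral_pushforward.
by apply: eq_measure_integral => A mA _; exact: lebesgue_measureN.
Qed.

Lemma lebesgue_tonelli (H : R * R -> \bar R) :
  measurable_fun setT H -> (forall p, 0 <= H p) ->
  \int[mu]_x \int[mu]_y H (x, y) = \int[mu]_y \int[mu]_x H (x, y).
Proof. by move=> mH H0; exact: (fubini_tonelli (m1 := mu) (m2 := mu) H mH H0). Qed.

Let measurable_shear (a : R) :
  measurable_fun setT (fun p : R * R => (p.1 + a * p.2, p.2)%R) /\
  measurable_fun setT (fun p : R * R => (p.1, p.2 + a * p.1)%R).
Proof.
by split; apply: measurable_fun_pair => //=; apply: measurable_funD => //;
  exact: measurable_funM.
Qed.

(** With [y] fixed the shear is a translation in [x]; Tonelli brings the [x]-integral inside. *)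
Let integral_shear1 (a : R) (H : R * R -> \bar R) :
  measurable_fun setT H -> (forall p, 0 <= H p) ->
  \int[mu]_x \int[mu]_y H (x + a * y, y)%R = \int[mu]_x \int[mu]_y H (x, y).
Proof.
move=> mH H0; rewrite [RHS](lebesgue_tonelli _ mH H0).
transitivity (\int[mu]_y \int[mu]_x H (x + a * y, y)%R).
  apply: (lebesgue_tonelli (fun p : R * R => H (p.1 + a * p.2, p.2)%R)) => //.
  by apply: measurableT_comp mH _; exact: (measurable_shear a).1.
apply: eq_integral => y _.
rewrite (ge0_integral_shift _ (fun x => H (x, y)))//.
by apply: measurableT_comp mH _; exact: measurable_fun_pair.
Qed.

Let integral_shear2 (a : R) (H : R * R -> \bar R) :
  measurable_fun setT H -> (forall p, 0 <= H p) ->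
  \int[mu]_x \int[mu]_y H (x, y + a * x)%R = \int[mu]_x \int[mu]_y H (x, y).
Proof.
move=> mH H0; apply: eq_integral => x _.
rewrite (ge0_integral_shift _ (fun y => H (x, y)))//.
by apply: measurableT_comp mH _; exact: measurable_fun_pair.
Qed.

(* A plane rotation is a product of three shears. *)
Lemma lebesgue_integral_rotation (c s : R) (G : R * R -> \bar R) :
  (0 <= c)%R -> (c ^+ 2 + s ^+ 2 = 1)%R ->
  measurable_fun setT G -> (forall p, 0 <= G p) ->
  \int[mu]_x \int[mu]_y G (c * x - s * y, s * x + c * y)%R =
  \int[mu]_x \int[mu]_y G (x, y).
Proof.
move=> c0 cs1 mG G0.
have c1 : (1 + c != 0)%R by rewrite gt_eqF// ltr_wpDr.
(* For [c] and [s] the cosine and sine of an angle, [a] is minus the tangent of half the angle: the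
   rotation is the shear by [a], then by [s], then by [a]. The sign condition on [c] keeps [1 + c]
   away from [0]. *)
pose a := (- (s / (1 + c)))%R.
have mG1 := measurableT_comp mG (measurable_shear a).1.
have mG2 := measurableT_comp mG1 (measurable_shear s).2.
rewrite -[RHS](integral_shear1 a _ mG G0).
rewrite -[RHS](integral_shear2 s _ mG1 (fun p => G0 _)).
rewrite -[RHS](integral_shear1 a _ mG2 (fun p => G0 _)).
have s2 : (s ^+ 2 = (1 - c) * (1 + c))%R.
  by transitivity (c ^+ 2 + s ^+ 2 - c ^+ 2)%R; [ring | rewrite cs1; ring].
have as_ : (a * s = c - 1)%R by rewrite /a mulNr mulrAC -expr2 s2 mulfK//; ring.
have ac : (a * (1 + c) = - s)%R by rewrite /a mulNr divfK.
apply: eq_integral => x _; apply: eq_integral => y _; congr (G (_, _)).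
  transitivity (x + (a * s) * x + y * (a * (1 + c)) + y * a * (a * s - (c - 1)))%R.
    by rewrite as_ ac; ring.
  by rewrite /=; ring.
transitivity (s * x + y + (a * s) * y)%R; last by rewrite /=; ring.
by rewrite as_; ring.
Qed.

End lebesgue_invariance.

Section integral_density.
Local Open Scope ereal_scope.
Context d (T : measurableType d) (R : realType).
Variables (mu nu : {measure set T -> \bar R}) (p : T -> R).
Hypotheses (mp : measurable_fun setT p) (p0 : forall x, (0 <= p x)%R).
Hypothesis nuE : forall A, measurable A -> nu A = \int[mu]_(x in A) (p x)%:E.

Import HBNNSimple.

(** Both sides pass to the limit along increasing simple approximations, which reduces the claim to
    indicators, where it is [nuE]. *)
Lemma ge0_integral_density (f : T -> \bar R) :
  measurable_fun setT f -> (forall x, 0 <= f x) ->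
  \int[nu]_x f x = \int[mu]_x (f x * (p x)%:E).
Proof.
move=> mf f0.
have phi0 x : 0 <= (p x)%:E by rewrite lee_fin.
have mphi : measurable_fun setT (fun x => (p x)%:E) by exact/measurable_EFinP.
pose f_ := nnsfun_approx measurableT mf.
have mf_ n : measurable_fun setT (fun x => (f_ n x)%:E).
  by apply/measurable_EFinP; exact: measurable_funP.
transitivity (limn (fun n => \int[nu]_x (f_ n x)%:E)).
  rewrite -monotone_convergence => [||n|n x _|x _ a b ab].
  - apply: eq_integral => x _; apply/esym/cvg_lim => //=.
    exact: cvg_nnsfun_approx.
  - by [].
  - exact: mf_.
  - by rewrite lee_fin.
  - by rewrite lee_fin//; exact/lefP/nd_nnsfun_approx.
transitivity (limn (fun n => \int[mu]_x ((f_ n x)%:E * (p x)%:E))); last first.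
  rewrite -monotone_convergence => [||n|n x _|x _ a b ab].
  - apply: eq_integral => x _; apply/cvg_lim => //=.
    apply: cvgeZr => //; exact: cvg_nnsfun_approx.
  - by [].
  - exact: emeasurable_funM.
  - by rewrite mule_ge0// lee_fin.
  - apply: lee_wpmul2r => //.
    by rewrite lee_fin//; exact/lefP/nd_nnsfun_approx.
congr (limn _); apply/funext => n.
move: (f_ n) => h {mf_}.
under [LHS]eq_integral do rewrite fimfunE -fsumEFin//.
rewrite [LHS]ge0_integral_fsum//; last 2 first.
  - by move=> r; exact/measurable_EFinP/measurableT_comp.
  - by move=> k x _; rewrite EFinM nnfun_muleindic_ge0.
under [RHS]eq_integral.
  move=> x xD; rewrite fimfunE -fsumEFin// muleC ge0_mule_fsumr; last first.
    by move=> r; rewrite EFinM nnfun_muleindic_ge0.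
  over.
rewrite [RHS]ge0_integral_fsum//; last 2 first.
  - by move=> r; apply: emeasurable_funM => //; apply/measurable_EFinP/measurableT_comp.
  - by move=> k x _; rewrite EFinM mule_ge0// nnfun_muleindic_ge0.
apply: eq_fsbigr => r /[!inE] -[x _ hx].
have r0 : (0 <= r)%R by rewrite -hx.
under eq_integral do rewrite EFinM.
rewrite ge0_integralZl//; last exact/measurable_EFinP.
under [RHS]eq_integral do rewrite EFinM muleCA.
rewrite ge0_integralZl//; last 2 first.
- by apply: emeasurable_funM => //; exact/measurable_EFinP.
- by move=> y _; rewrite mule_ge0// lee_fin.
rewrite integral_indic// setIT; congr *%E.
rewrite nuE// integral_mkcond; apply: eq_integral => y _.
rewrite patchE indicE; case: (y \in _); by rewrite ?mule1 ?mule0.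
Qed.

End integral_density.

Section gaussian_integral.
Local Open Scope ereal_scope.
Context {R : realType}.
Local Notation mu := (@lebesgue_measure R).
Local Notation gam := (normal_prob (0 : R) 1).
Local Notation phi := (normal_pdf (0 : R) 1).

Lemma ge0_integral_normal_prob (f : R -> \bar R) :
  measurable_fun setT f -> (forall x, 0 <= f x) ->
  \int[gam]_x f x = \int[mu]_x (f x * (phi x)%:E).
Proof.
move=> mf f0; apply: ge0_integral_density => //.
- exact: measurable_normal_pdf.
- by move=> x; exact: normal_pdf_ge0.
Qed.

Lemma normal_pdf01E (x : R) : phi x = (normal_peak 1 * expR (- (x ^+ 2 / 2)))%R.
Proof.
by rewrite /normal_pdf oner_eq0 /normal_fun subr0 expr1n mulNr.
Qed.

Lemma normal_integral_opp (f : R -> \bar R) :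
  measurable_fun setT f -> (forall x, 0 <= f x) ->
  \int[gam]_x f (- x)%R = \int[gam]_x f x.
Proof.
move=> mf f0.
have mphi : measurable_fun setT (fun x => (phi x)%:E).
  by apply/measurable_EFinP; exact: measurable_normal_pdf.
rewrite !ge0_integral_normal_prob//; last exact: measurableT_comp.
rewrite -(ge0_integral_opp (fun x => f x * (phi x)%:E)) => [||x].
- by apply: eq_integral => x _; rewrite !normal_pdf01E sqrrN.
- exact: emeasurable_funM.
- by rewrite mule_ge0// lee_fin normal_pdf_ge0.
Qed.

(** The product density depends on [x ^+ 2 + y ^+ 2] only, so the invariance of Lebesgue measure
    carries over. *)
Lemma normal_integral_rotation (c s : R) (G : R * R -> \bar R) :
  (0 <= c)%R -> (c ^+ 2 + s ^+ 2 = 1)%R ->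
  measurable_fun setT G -> (forall p, 0 <= G p) ->
  \int[gam]_x \int[gam]_y G (c * x - s * y, s * x + c * y)%R =
  \int[gam]_x \int[gam]_y G (x, y).
Proof.
move=> c0 cs mG G0.
have mphi : measurable_fun setT (fun x => (phi x)%:E).
  by apply/measurable_EFinP; exact: measurable_normal_pdf.
have phi0 x : 0 <= (phi x)%:E by rewrite lee_fin normal_pdf_ge0.
have key (H : R * R -> \bar R) : measurable_fun setT H -> (forall p, 0 <= H p) ->
    \int[gam]_x \int[gam]_y H (x, y) =
    \int[mu]_x \int[mu]_y (H (x, y) * (phi x * phi y)%:E).
  move=> mH H0.
  have mHx x : measurable_fun setT (fun y => H (x, y)).
    by apply: measurableT_comp mH _; exact: measurable_fun_pair.
  rewrite ge0_integral_normal_prob; last 2 first.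
  - exact: (measurable_fun_fubini_tonelli_F (m2 := gam) H mH H0).
  - by move=> x; apply: integral_ge0.
  apply: eq_integral => x _.
  rewrite ge0_integral_normal_prob//.
  rewrite -ge0_integralZr//; last 2 first.
  - exact: (emeasurable_funM (mHx x) mphi).
  - by move=> y _; rewrite mule_ge0.
  by apply: eq_integral => y _; rewrite EFinM -muleA [X in _ * X]muleC.
rewrite (key (fun p => G (c * p.1 - s * p.2, s * p.1 + c * p.2)%R))//; last first.
  apply: (measurableT_comp mG); apply: measurable_fun_pair => //=.
    by apply: measurable_funB => //; exact: measurable_funM.
  by apply: measurable_funD => //; exact: measurable_funM.
rewrite (key G mG G0).
pose W (p : R * R) := G p * (phi p.1 * phi p.2)%:E.
have mW : measurable_fun setT W.
  apply: emeasurable_funM => //; apply/measurable_EFinP; apply: measurable_funM.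
    by apply: measurableT_comp => //; exact: measurable_normal_pdf.
  by apply: measurableT_comp => //; exact: measurable_normal_pdf.
have W0 p : 0 <= W p by rewrite mule_ge0// lee_fin mulr_ge0// normal_pdf_ge0.
rewrite -[RHS](lebesgue_integral_rotation c s W c0 cs mW W0).
apply: eq_integral => x _; apply: eq_integral => y _; congr (_ * _%:E).
rewrite /= !normal_pdf01E mulrACA [RHS]mulrACA -!expRD; congr (_ * expR _)%R.
have s2 : (s ^+ 2 = 1 - c ^+ 2)%R by rewrite -cs addrC addKr.
have -> : ((c * x - s * y) ^+ 2 = c^+2 * x^+2 + s^+2 * y^+2 - 2*c*s*x*y)%R by ring.
have -> : ((s * x + c * y) ^+ 2 = s^+2 * x^+2 + c^+2 * y^+2 + 2*c*s*x*y)%R by ring.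
by rewrite s2; field.
Qed.

End gaussian_integral.

(** * The one-dimensional Prekopa-Leindler inequality *)

Section powR_convexity.
Context {R : realType}.

(** Young's inequality for the conjugate exponents [l^-1] and [(1 - l)^-1]. *)
Lemma powR_amgm (l a b : R) : 0 < l < 1 -> 0 <= a -> 0 <= b ->
  a `^ l * b `^ (1 - l) <= l * a + (1 - l) * b.
Proof.
move=> /andP[l0 l1] a0 b0.
have l1' : 0 < 1 - l by rewrite subr_gt0.
have := @conjugate_powR R (a `^ l) (b `^ (1 - l)) l^-1 (1 - l)^-1
  (powR_ge0 _ _) (powR_ge0 _ _).
rewrite !invr_gt0 !invrK -!powRrM !divff ?gt_eqF// !powRr1//.
by move=> /(_ l0 l1' (subrKC _ _)); rewrite [a * _]mulrC [b * _]mulrC.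
Qed.

Lemma powR_cvx_idem (l a : R) : 0 <= a -> a `^ l * a `^ (1 - l) = a.
Proof. by move=> a0; rewrite -powRD ?subrKC ?powRr1 ?oner_eq0. Qed.

Lemma le_powR_cvx (l a b a' b' : R) : 0 < l < 1 -> 0 <= a <= a' -> 0 <= b <= b' ->
  a `^ l * b `^ (1 - l) <= a' `^ l * b' `^ (1 - l).
Proof.
move=> /andP[l0 l1] /andP[a0 aa'] /andP[b0 bb'].
have l1' : 0 <= 1 - l by rewrite subr_ge0 ltW.
have a'0 := le_trans a0 aa'; have b'0 := le_trans b0 bb'.
by rewrite ler_pM ?powR_ge0//; apply: ge0_ler_powR; rewrite ?nnegrE// ltW.
Qed.

End powR_convexity.

Section quasiconcave.
Context {R : realType}.

(** Stated through strict superlevel sets, since these are what the layer-cake formula integrates;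
    being intervals, they are measurable at once. *)
Definition quasiconcave (f : R -> R) := forall t, is_interval [set x | t < f x].

Lemma quasiconcave_measurable (f : R -> R) : quasiconcave f -> measurable_fun setT f.
Proof.
move=> qf mD; apply: (measurability _ (RGenOInfty.measurableE R)) => //.
move=> /= _ [_ [x ->] <-]; rewrite setTI.
have -> : f @^-1` `]x, +oo[ = [set y | x < f y].
  by apply/seteqP; split => y /=; rewrite in_itv/= andbT.
exact: (is_interval_measurable (qf x)).
Qed.

(** A weighted geometric mean is at least the smaller of its two terms, so [f] exceeds [t] between
    any two points where it does. *)
Lemma quasiconcave_cvx (f : R -> R) :
  (forall x, 0 <= f x) ->
  (forall l x y, 0 < l < 1 ->
    f x `^ l * f y `^ (1 - l) <= f (l * x + (1 - l) * y)) ->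
  quasiconcave f.
Proof.
move=> f0 fc t x y /= tx ty z /andP[].
rewrite le_eqVlt => /predU1P[<-//|xz].
rewrite le_eqVlt => /predU1P[->//|zy].
have [t0|t0] := ltP t 0; first exact: lt_le_trans (f0 z).
have yx : 0 < y - x by rewrite subr_gt0 (lt_trans xz).
pose l := (y - z) / (y - x).
have l01 : 0 < l < 1.
  apply/andP; split; first by rewrite divr_gt0// subr_gt0.
  by rewrite ltr_pdivrMr// mul1r ltrD2l ltrN2.
have -> : z = l * x + (1 - l) * y.
  by rewrite /l; field; rewrite gt_eqF.
apply: lt_le_trans (fc _ _ _ l01).
pose m := Num.min (f x) (f y).
have tm : t < m by rewrite lt_min tx ty.
have m0 : 0 <= m by rewrite (le_trans t0)// ltW.
apply: lt_le_trans tm _; rewrite -[leLHS](powR_cvx_idem l)//.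
by apply: le_powR_cvx => //; rewrite m0 ge_min lexx ?orbT.
Qed.

End quasiconcave.

Section brunn_minkowski_intervals.
Local Open Scope ereal_scope.
Context {R : realType}.
Local Notation mu := (@lebesgue_measure R).

(** Together with the opposite bound that follows, this trades the length of an interval for
    differences of its points, so endpoints need not be attained and open and closed ends are
    treated alike. *)
Lemma lebesgue_measure_interval_le (A : set R) (s : R) :
  is_interval A -> A !=set0 ->
  (forall a b, A a -> A b -> (b - a <= s)%R) -> mu A <= s%:E.
Proof.
move=> iA [a0 Aa0] As.
have ubA : has_ubound A.
  by exists (a0 + s)%R => b Ab; rewrite -lerBlDl; exact: As.
have lbA : has_lbound A.
  by exists (a0 - s)%R => b Ab; rewrite lerBlDl -lerBlDr; exact: As.
have AI : A `<=` `[inf A, sup A].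
  by move=> x Ax /=; rewrite in_itv/= ge_inf// ub_le_sup.
have infsup : (sup A <= s + inf A)%R.
  apply: ge_sup; first by exists a0.
  move=> b Ab /=; rewrite -lerBlDl; apply: lb_le_inf; first by exists a0.
  by move=> a Aa; rewrite lerBlDl -lerBlDr; exact: As.
apply: (@le_trans _ _ (mu `[inf A, sup A])).
  by apply: le_measure => //; rewrite inE; [exact: is_interval_measurable|exact: measurable_itv].
rewrite lebesgue_measure_itv/=; case: ifP => _.
  by rewrite -EFinB lee_fin lerBlDr.
by rewrite lee_fin (le_trans _ (As _ _ Aa0 Aa0))// subrr.
Qed.

Lemma lebesgue_measure_interval_ge (A : set R) (a b : R) :
  is_interval A -> A a -> A b -> (b - a)%:E <= mu A.
Proof.
move=> iA Aa Ab; have [ab|ba] := ltP a b; last first.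
  by apply: (@le_trans _ _ 0) => //; rewrite lee_fin subr_le0.
apply: (@le_trans _ _ (mu `[a, b])).
  by rewrite lebesgue_measure_itv/= lte_fin ab EFinB.
apply: le_measure; rewrite ?inE; [exact: measurable_itv|exact: is_interval_measurable|].
by move=> x /=; rewrite in_itv/=; exact: iA.
Qed.

(** Two points of [A] and two of [B] give two points of [C] whose difference is the weighted sum of
    the differences. Passing to the supremum first over [B], then over [A], yields the lengths; the
    same bounds show that they are finite once [mu C] is. *)
Lemma brunn_minkowski_interval (l : R) (A B C : set R) : (0 < l < 1)%R ->
  is_interval A -> is_interval B -> is_interval C -> A !=set0 -> B !=set0 ->
  (forall a b, A a -> B b -> C (l * a + (1 - l) * b)%R) ->
  l%:E * mu A + (1 - l)%:E * mu B <= mu C.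
Proof.
move=> /andP[l0 l1] iA iB iC A0 B0 ABC.
have l1' : (0 < 1 - l)%R by rewrite subr_gt0.
have [->|Cfin] := eqVneq (mu C) +oo; first by rewrite leey.
have {}Cfin : mu C \is a fin_num by rewrite ge0_fin_numE// ltey.
rewrite -(fineK Cfin); set c := fine (mu C).
have key a1 a2 b1 b2 : A a1 -> A a2 -> B b1 -> B b2 ->
    (l * (a2 - a1) + (1 - l) * (b2 - b1) <= c)%R.
  move=> Aa1 Aa2 Bb1 Bb2; rewrite -lee_fin /c fineK//.
  have := lebesgue_measure_interval_ge _ _ _ iC (ABC _ _ Aa1 Bb1) (ABC _ _ Aa2 Bb2).
  by apply: le_trans; rewrite lee_fin le_eqVlt; apply/orP; left; apply/eqP; ring.
have keyB a1 a2 : A a1 -> A a2 -> mu B <= ((c - l * (a2 - a1)) / (1 - l))%:E.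
  move=> Aa1 Aa2; apply: lebesgue_measure_interval_le => // b1 b2 Bb1 Bb2.
  by rewrite ler_pdivlMr//; have := key _ _ _ _ Aa1 Aa2 Bb1 Bb2; lra.
have Bfin : mu B \is a fin_num.
  have [a Aa] := A0.
  by rewrite ge0_fin_numE// (le_lt_trans (keyB _ _ Aa Aa))// ltry.
have keyA : mu A <= ((c - (1 - l) * fine (mu B)) / l)%:E.
  apply: lebesgue_measure_interval_le => // a1 a2 Aa1 Aa2.
  have := keyB _ _ Aa1 Aa2; rewrite -{1}(fineK Bfin) lee_fin ler_pdivlMr// => h.
  by rewrite ler_pdivlMr//; lra.
have Afin : mu A \is a fin_num.
  by rewrite ge0_fin_numE// (le_lt_trans keyA)// ltry.
move: keyA; rewrite -(fineK Afin) -(fineK Bfin) -!EFinM -EFinD !lee_fin.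
by rewrite ler_pdivlMr//; lra.
Qed.

End brunn_minkowski_intervals.

Section prekopa_leindler.
Local Open Scope ereal_scope.
Context {R : realType}.
Local Notation mu := (@lebesgue_measure R).

Let hypograph (f : R -> R) (p : R * R) : \bar R :=
  (((0 < p.2) && (p.2 < f p.1))%R : nat)%:R%:E.

Let measurable_hypograph (f : R -> R) : measurable_fun setT f ->
  measurable_fun setT (hypograph f).
Proof.
move=> mf; apply/measurable_EFinP.
have -> : (fun p => (((0 < p.2) && (p.2 < f p.1))%R : nat)%:R : R) =
    (fun p => if ((0 < p.2) && (p.2 < f p.1))%R then 1%R else 0%R).
  by apply/funext => p; case: ifP.
apply: measurable_fun_if => //.
apply: measurable_and; apply: measurable_fun_ltr => //.
by apply: measurableT_comp mf _.
Qed.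

Let hypograph_ge0 (f : R -> R) p : 0 <= hypograph f p.
Proof. by rewrite lee_fin ler0n. Qed.

(** The condition [0 < t] sits inside the set, so the layer-cake integral can run over the whole
    line. *)
Let level (f : R -> R) (t : R) : \bar R := mu [set x | 0 < t < f x]%R.

Let hypograph_fst (f : R -> R) (x : R) : (0 <= f x)%R ->
  \int[mu]_t hypograph f (x, t) = (f x)%:E.
Proof.
move=> fx; have -> : (fun t => hypograph f (x, t)) =
    (fun t => (\1_(`]0%R, (f x)[) t)%:E) :> (R -> \bar R).
  by apply/funext => t; rewrite /hypograph /= indicE mem_setE in_itv.
rewrite integral_indic// setIT -[LHS]/(mu `]0%R, f x[%classic) lebesgue_measure_itv/= lte_fin.
by case: ltgtP fx => // [_|<-] _; rewrite ?sube0.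
Qed.

Let hypograph_snd (f : R -> R) (t : R) : measurable_fun setT f ->
  \int[mu]_x hypograph f (x, t) = level f t.
Proof.
move=> mf.
have -> : (fun x => hypograph f (x, t)) =
    (fun x => (\1_([set x | 0 < t < f x]%R) x)%:E) :> (R -> \bar R).
  apply/funext => x; rewrite /hypograph /= indicE.
  by congr ((nat_of_bool _)%:R%:E); apply/idP/idP; rewrite inE.
rewrite integral_indic ?setIT//.
have -> : [set x | 0 < t < f x]%R = (if (0 < t)%R then f @^-1` `]t, +oo[ else set0).
  by apply/seteqP; split => x /=; case: (0 < t)%R; rewrite //= in_itv/= andbT.
by case: ifP => // _; rewrite -[X in measurable X]setTI; exact: mf.
Qed.

Let layer_cake (f : R -> R) : measurable_fun setT f -> (forall x, (0 <= f x)%R) ->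
  \int[mu]_x (f x)%:E = \int[mu]_t level f t.
Proof.
move=> mf f0.
transitivity (\int[mu]_x \int[mu]_t hypograph f (x, t)).
  by apply: eq_integral => x _; rewrite hypograph_fst.
rewrite (fubini_tonelli (m1 := mu) (m2 := mu) (hypograph f) (measurable_hypograph f mf) (hypograph_ge0 f)).
by apply: eq_integral => t _; rewrite hypograph_snd.
Qed.

Let measurable_level (f : R -> R) : measurable_fun setT f ->
  measurable_fun setT (level f).
Proof.
move=> mf.
have -> : level f = (fun t => \int[mu]_x hypograph f (x, t)).
  by apply/funext => t; rewrite hypograph_snd.
exact: (measurable_fun_fubini_tonelli_G (m1 := mu) (hypograph f)
  (measurable_hypograph f mf) (hypograph_ge0 f)).
Qed.

(** When both suprema are [1], the superlevel sets of [f] and [g] are nonempty for every [t] in []0,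
    1[], and Brunn-Minkowski applies level by level; at all other levels the left side is [0].
    Integrating over [t] gives the arithmetic-mean form. *)
Let prekopa_leindler_normalized (l : R) (f g h : R -> R) : (0 < l < 1)%R ->
  (forall x, (0 <= f x <= 1)%R) -> (forall x, (0 <= g x <= 1)%R) ->
  (forall x, (0 <= h x)%R) ->
  quasiconcave f -> quasiconcave g -> quasiconcave h ->
  (forall t, (t < 1)%R -> exists x, (t < f x)%R) ->
  (forall t, (t < 1)%R -> exists x, (t < g x)%R) ->
  (forall x y, (f x `^ l * g y `^ (1 - l) <= h (l * x + (1 - l) * y))%R) ->
  l%:E * (\int[mu]_x (f x)%:E) + (1 - l)%:E * (\int[mu]_x (g x)%:E) <=
  \int[mu]_x (h x)%:E.
Proof.
move=> l01 f01 g01 h0 qf qg qh f1 g1 fgh.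
have [l0 l1] : (0 <= l /\ 0 <= 1 - l)%R.
  by move: l01 => /andP[l0 l1]; rewrite subr_ge0 !ltW.
have [mf mg mh] : [/\ measurable_fun setT f, measurable_fun setT g & measurable_fun setT h].
  by split; exact: quasiconcave_measurable.
rewrite !layer_cake//; last 2 first.
- by move=> x; case/andP: (g01 x).
- by move=> x; case/andP: (f01 x).
rewrite -!ge0_integralZl//; try exact: measurable_level; rewrite ?lee_fin//.
rewrite -ge0_integralD//; last 4 first.
- by move=> t _; rewrite mule_ge0.
- by apply: emeasurable_funM => //; exact: measurable_level.
- by move=> t _; rewrite mule_ge0.
- by apply: emeasurable_funM => //; exact: measurable_level.
apply: ge0_le_integral => //.
- by move=> t _; rewrite adde_ge0// mule_ge0.
- by apply: emeasurable_funD; apply: emeasurable_funM => //; exact: measurable_level.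
- exact: measurable_level.
move=> t _.
have level0 (k : R -> R) : (forall x, (0 <= k x <= 1)%R) -> ~~ (0 < t < 1)%R -> level k t = 0.
  move=> k01 t01; rewrite /level; have -> : [set x | 0 < t < k x]%R = set0.
    apply/seteqP; split => // x /= /andP[t0 tk]; move: t01; rewrite t0/=.
    by rewrite (lt_le_trans tk)//; case/andP: (k01 x).
  exact: measure0.
have [/andP[t0 t1]|t01] := boolP (0 < t < 1)%R; last first.
  by rewrite (level0 f)// (level0 g)// !mule0 adde0.
have levelE k : level k t = mu [set x | t < k x]%R.
  by rewrite /level; congr (mu _); apply/seteqP; split => x /=; rewrite t0.
rewrite !levelE.
apply: (brunn_minkowski_interval _ _ _ _ l01 (qf t) (qg t) (qh t) (f1 t t1) (g1 t t1)).
move=> a b /= ta tb; apply: lt_le_trans (fgh a b).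
pose m := Num.min (f a) (g b).
have tm : (t < m)%R by rewrite lt_min ta tb.
have m0 : (0 <= m)%R by rewrite (le_trans (ltW t0))// ltW.
apply: lt_le_trans tm _; rewrite -[leLHS](powR_cvx_idem l)//.
by apply: le_powR_cvx => //; rewrite m0 ge_min lexx ?orbT.
Qed.

(** Dividing [f] and [g] by their suprema, finite thanks to [M], reduces to the normalized case, and
    the inequality of arithmetic and geometric means then turns the sum into a product. *)
Lemma prekopa_leindler (l M F G H : R) (f g h : R -> R) : (0 < l < 1)%R ->
  (forall x, (0 <= f x <= M)%R) -> (forall x, (0 <= g x <= M)%R) ->
  (forall x, (0 <= h x)%R) ->
  quasiconcave f -> quasiconcave g -> quasiconcave h ->
  (forall x y, (f x `^ l * g y `^ (1 - l) <= h (l * x + (1 - l) * y))%R) ->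
  \int[mu]_x (f x)%:E = F%:E -> \int[mu]_x (g x)%:E = G%:E ->
  \int[mu]_x (h x)%:E = H%:E ->
  (F `^ l * G `^ (1 - l) <= H)%R.
Proof.
move=> l01 fM gM h0 qf qg qh fgh intf intg inth.
have H0 : (0 <= H)%R by rewrite -lee_fin -inth integral_ge0// => x _; rewrite lee_fin.
have [l0 l1] : (0 < l /\ 0 < 1 - l)%R.
  by move: l01 => /andP[l0 l1]; rewrite subr_gt0.
have zero (k : R -> R) (K : R) : (forall x, (0 <= k x <= M)%R) ->
    \int[mu]_x (k x)%:E = K%:E -> sup (range k) = 0%R -> K = 0%R.
  move=> kM intk k0; apply: EFin_inj; rewrite -intk integral0_eq// => x _.
  congr EFin; apply/eqP; rewrite eq_le; case/andP: (kM x) => -> _; rewrite andbT.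
  rewrite -k0; apply: ub_le_sup; last by exists x.
  by exists M => _ [y _ <-]; case/andP: (kM y).
have supE (k : R -> R) : (forall x, (0 <= k x <= M)%R) ->
    [/\ (0 <= sup (range k))%R, forall x, (k x <= sup (range k))%R &
      forall t, (t < sup (range k))%R -> exists x, (t < k x)%R].
  move=> kM.
  have ubk : has_ubound (range k) by exists M => _ [y _ <-]; case/andP: (kM y).
  have ksup x : (k x <= sup (range k))%R by apply: ub_le_sup => //; exists x.
  split => //.
    by apply: le_trans (ksup 0%R); case/andP: (kM 0%R).
  move=> t tk; have [|_ [x _ <-] tx] := sup_gt _ tk; last by exists x.
  by exists (k 0%R), 0%R.
have [A0 fA Af] := supE _ fM; have [B0 gB Bg] := supE _ gM.
set A := sup (range f) in A0 fA Af; set B := sup (range g) in B0 gB Bg.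
have [AE|An0] := eqVneq A 0%R.
  by rewrite (zero f F)// powR0 ?gt_eqF// mul0r.
have [BE|Bn0] := eqVneq B 0%R.
  by rewrite (zero g G)// powR0 ?(gt_eqF l1)// mulr0.
have {}A0 : (0 < A)%R by rewrite lt_neqAle eq_sym An0.
have {}B0 : (0 < B)%R by rewrite lt_neqAle eq_sym Bn0.
(* The only scaling of [h] that keeps the pointwise hypothesis in balance once [f] and [g] are
   divided by [A] and [B]. *)
pose D := (A `^ l * B `^ (1 - l))%R.
have D0 : (0 < D)%R by rewrite mulr_gt0// powR_gt0.
have qdiv (k : R -> R) c : (0 < c)%R -> quasiconcave k -> quasiconcave (fun x => k x / c)%R.
  move=> c0 qk t x y /=; rewrite !ltr_pdivlMr// => tx ty z xzy.
  by rewrite ltr_pdivlMr//; exact: qk xzy.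
have intdiv (k : R -> R) K c : (0 < c)%R -> quasiconcave k -> (forall x, (0 <= k x)%R) ->
    \int[mu]_x (k x)%:E = K%:E -> \int[mu]_x (k x / c)%:E = (K / c)%:E.
  move=> c0 qk k0 intk; under eq_integral do rewrite EFinM.
  rewrite ge0_integralZr// ?intk//.
  - by apply/measurable_EFinP; exact: quasiconcave_measurable.
  - by move=> x _; rewrite lee_fin.
  - by rewrite lee_fin invr_ge0 ltW.
have f0 x : (0 <= f x)%R by case/andP: (fM x).
have g0 x : (0 <= g x)%R by case/andP: (gM x).
have powdiv (a b c : R) : (0 <= a)%R -> (0 < b)%R -> ((a / b) `^ c = a `^ c / b `^ c)%R.
  move=> a0 b0; rewrite powRM// ?invr_ge0 ?ltW//; congr *%R.
  by rewrite -powR_inv1 ?ltW// powRAC powR_inv1// powR_ge0.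
have := prekopa_leindler_normalized l (fun x => f x / A)%R (fun x => g x / B)%R
  (fun x => h x / D)%R l01.
rewrite (intdiv f F A)// (intdiv g G B)// (intdiv h H D)//.
have F0 : (0 <= F)%R by rewrite -lee_fin -intf integral_ge0// => x _; rewrite lee_fin.
have G0 : (0 <= G)%R by rewrite -lee_fin -intg integral_ge0// => x _; rewrite lee_fin.
move=> PL.
have {PL} : (l * (F / A) + (1 - l) * (G / B) <= H / D)%R.
  rewrite -lee_fin EFinD !EFinM -!EFinM; apply: PL.
  - by move=> x; rewrite (divr_ge0 (f0 x) (ltW A0))/= ler_pdivrMr// mul1r.
  - by move=> x; rewrite (divr_ge0 (g0 x) (ltW B0))/= ler_pdivrMr// mul1r.
  - by move=> x; exact: divr_ge0 (h0 x) (ltW D0).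
  - exact: qdiv.
  - exact: qdiv.
  - exact: qdiv.
  - move=> t t1; have [|x] := Af (t * A)%R; first by rewrite gtr_pMl.
    by exists x; rewrite ltr_pdivlMr.
  - move=> t t1; have [|x] := Bg (t * B)%R; first by rewrite gtr_pMl.
    by exists x; rewrite ltr_pdivlMr.
  - move=> x y; rewrite !powdiv// mulrACA -invfM ler_pM2r ?invr_gt0//.
move/(le_trans (powR_amgm l (F / A) (G / B) l01 (divr_ge0 F0 (ltW A0)) (divr_ge0 G0 (ltW B0)))).
by rewrite !powdiv// mulrACA -invfM ler_pM2r ?invr_gt0.
Qed.

End prekopa_leindler.

Definition logconcave {R : realType} (f : R -> R) := forall l x y, 0 < l < 1 ->
  f x `^ l * f y `^ (1 - l) <= f (l * x + (1 - l) * y).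

(** * Prekopa-Leindler for the Gaussian weight on the line *)

Section gaussian_mean.
Context {R : realType}.
Local Notation gam := (normal_prob (0 : R) 1).
Local Notation phi := (normal_pdf (0 : R) 1).

Lemma normal_pdf_logconcave : logconcave phi.
Proof.
move=> l x y /andP[l0 l1]; rewrite !normal_pdf01E.
have pk := normal_peak_ge0 (1 : R).
rewrite !powRM ?expR_ge0// mulrACA powR_cvx_idem// ler_wpM2l//.
rewrite /powR !gt_eqF ?expR_gt0// !expRK -expRD ler_expR.
(* This is exactly the gap between the two exponents, that is, the convexity defect of half the
   square. *)
have : 0 <= l * (1 - l) * (x - y) ^+ 2 / 2.
  by rewrite divr_ge0// mulr_ge0 ?sqr_ge0// mulr_ge0 ?subr_ge0 ?(ltW l0) ?(ltW l1).
have -> : l * (1 - l) * (x - y) ^+ 2 / 2 =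
  (- ((l * x + (1 - l) * y) ^+ 2 / 2)) -
  (l * - (x ^+ 2 / 2) + (1 - l) * - (y ^+ 2 / 2)) by field.
by rewrite subr_ge0.
Qed.

Definition gmean (f : R -> R) : R := fine (\int[gam]_x (f x)%:E).

Lemma gmeanE (f : R -> R) : (forall x, 0 <= f x <= 1) ->
  (\int[gam]_x (f x)%:E = (gmean f)%:E)%E.
Proof.
move=> f01; rewrite fineK// ge0_fin_numE; last first.
  by apply: integral_ge0 => x _; rewrite lee_fin; case/andP: (f01 x).
apply: (@le_lt_trans _ _ (\int[gam]_x 1)%E); last first.
  by rewrite integral_cst//= mul1e (le_lt_trans (probability_le1 _ _))// ltry.
by apply: ge0_le_integral_nomeas => x; rewrite lee_fin; case/andP: (f01 x).
Qed.

Lemma gmean_itv (f : R -> R) : (forall x, 0 <= f x <= 1) -> 0 <= gmean f <= 1.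
Proof.
move=> f01; rewrite -!lee_fin -gmeanE//; apply/andP; split.
  by apply: integral_ge0 => x _; rewrite lee_fin; case/andP: (f01 x).
apply: (@le_trans _ _ (\int[gam]_x 1)%E); last first.
  by rewrite integral_cst//= mul1e probability_le1.
by apply: ge0_le_integral_nomeas => x; rewrite lee_fin; case/andP: (f01 x).
Qed.

Lemma gmean_cst (k : R) : gmean (fun=> k) = k.
Proof.
have gT : gam setT = 1%E by exact: probability_setT.
by rewrite /gmean integral_cst//= gT mule1.
Qed.

Lemma gmean_opp (f : R -> R) : measurable_fun setT f -> (forall x, 0 <= f x) ->
  gmean (fun x => f (- x)) = gmean f.
Proof.
move=> mf f0; congr fine; apply: (normal_integral_opp (fun x => (f x)%:E)) => //.
exact/measurable_EFinP.
Qed.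

(** Multiplying each function by the log-concave density preserves the pointwise inequality and
    reduces to Lebesgue measure. The log-concavity of each single function makes the weighted
    functions quasiconcave, and the peak of the density bounds them. *)
Lemma gmean_prekopa (l : R) (f g h : R -> R) : 0 < l < 1 ->
  (forall x, 0 <= f x <= 1) -> (forall x, 0 <= g x <= 1) ->
  (forall x, 0 <= h x <= 1) ->
  logconcave f -> logconcave g -> logconcave h ->
  (forall x y, f x `^ l * g y `^ (1 - l) <= h (l * x + (1 - l) * y)) ->
  gmean f `^ l * gmean g `^ (1 - l) <= gmean h.
Proof.
move=> l01 f01 g01 h01 lf lg lh fgh.
have phi0 x : 0 <= phi x by exact: normal_pdf_ge0.
have weight k1 k2 k3 (t : R) : 0 < t < 1 -> (forall x, 0 <= k1 x <= 1) ->
    (forall x, 0 <= k2 x <= 1) -> (forall x, 0 <= k3 x <= 1) ->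
    (forall x y, k1 x `^ t * k2 y `^ (1 - t) <= k3 (t * x + (1 - t) * y)) ->
    forall x y, (k1 x * phi x) `^ t * (k2 y * phi y) `^ (1 - t) <=
      k3 (t * x + (1 - t) * y) * phi (t * x + (1 - t) * y).
  move=> t01 k101 k201 k301 k123 x y.
  have [/andP[k1x _] /andP[k2y _]] := (k101 x, k201 y).
  rewrite !powRM// mulrACA ler_pM ?mulr_ge0 ?powR_ge0//.
  exact: normal_pdf_logconcave.
have wqc k : (forall x, 0 <= k x <= 1) -> logconcave k ->
    quasiconcave (fun x => k x * phi x).
  move=> k01 lk; apply: quasiconcave_cvx.
    by move=> x; rewrite mulr_ge0//; case/andP: (k01 x).
  by move=> t x y t01; apply: weight => // x' y'; exact: lk.
have wint k : (forall x, 0 <= k x <= 1) -> logconcave k ->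
    (\int[lebesgue_measure]_x (k x * phi x)%:E = (gmean k)%:E)%E.
  move=> k01 lk; rewrite -gmeanE// ge0_integral_normal_prob//.
    apply/measurable_EFinP; apply: quasiconcave_measurable.
    apply: quasiconcave_cvx => [x|t x y t01]; last exact: lk.
    by case/andP: (k01 x).
  by move=> x; rewrite lee_fin; case/andP: (k01 x).
have wbnd k x : (forall x, 0 <= k x <= 1) -> 0 <= k x * phi x <= normal_peak 1.
  move=> k01; have /andP[kx0 kx1] := k01 x; rewrite mulr_ge0//=.
  by rewrite (le_trans (ler_piMl (phi0 x) kx1))// normal_pdf_ub// oner_neq0.
apply: (prekopa_leindler l (normal_peak 1) _ _ _ (fun x => f x * phi x)
  (fun x => g x * phi x) (fun x => h x * phi x) l01).
- by move=> x; exact: wbnd.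
- by move=> x; exact: wbnd.
- by move=> x; case/andP: (wbnd h x h01).
- exact: wqc.
- exact: wqc.
- exact: wqc.
- exact: weight.
- exact: wint.
- exact: wint.
- exact: wint.
Qed.

End gaussian_mean.

(** * Gaussian disintegration along a linear form *)

Section disintegration.
Context {R : realType}.
Local Notation gam := (normal_prob (0 : R) 1).

Definition unit_valued {T : Type} (F : T -> R) := forall x, 0 <= F x <= 1.

Definition cvx_seq (l : R) (x y : seq R) : seq R :=
  [seq l * p.1 + (1 - l) * p.2 | p <- zip x y].

Definition logconcave3 n l (F G H : seq R -> R) := forall x y,
  size x = n -> size y = n -> F x `^ l * G y `^ (1 - l) <= H (cvx_seq l x y).

Definition logconcave_seq n (F : seq R -> R) :=
  forall l, 0 < l < 1 -> logconcave3 n l F F F.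

(* Joint measurability of [(p, x) |-> G p x] for [x] of size [n], tested on measurable
   curves, which avoids putting a sigma-algebra on [seq R]. *)
Definition measurable_family n d (D : measurableType d) (G : D -> seq R -> R) :=
  forall d' (D' : measurableType d') (w : D' -> D) (xs : seq (D' -> R)),
    measurable_fun setT w -> (forall f, List.In f xs -> measurable_fun setT f) ->
    size xs = n -> measurable_fun setT (fun p => G (w p) [seq f p | f <- xs]).

(** A constant family over a dummy parameter space. *)
Definition measurable_seq n (F : seq R -> R) := measurable_family n _ R (fun=> F).

Definition dot_seq (x u : seq R) : R := \sum_(p <- zip x u) p.1 * p.2.

(* [E F t] is the conditional expectation of [F] given [dot_seq x u = sigma * t]. *)
Record disintegration (u : seq R) (sigma : R) (E : (seq R -> R) -> R -> R) : Prop := {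
  dis_unit : forall F, unit_valued F -> unit_valued (E F);
  dis_one : E (fun=> 1) = (fun=> 1);
  dis_measurable : forall d (D : measurableType d) (G : D -> seq R -> R),
    (forall p, unit_valued (G p)) -> measurable_family (size u) _ D G ->
    measurable_fun setT (fun q : D * R => E (G q.1) q.2);
  dis_logconcave : forall l F G H, 0 < l < 1 ->
    unit_valued F -> unit_valued G -> unit_valued H ->
    logconcave_seq (size u) F -> logconcave_seq (size u) G ->
    logconcave_seq (size u) H -> logconcave3 (size u) l F G H ->
    forall s t, E F s `^ l * E G t `^ (1 - l) <= E H (l * s + (1 - l) * t);
  dis_opp : forall F, unit_valued F -> measurable_seq (size u) F ->
    forall t, E (fun x => F (map -%R x)) t = E F (- t);
  dis_integral : forall F psi, unit_valued F -> measurable_seq (size u) F ->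
    measurable_fun setT psi -> unit_valued psi ->
    gauss_iter (size u) (fun x => (F x * psi (dot_seq x u))%:E) =
    (\int[gam]_t (E F t * psi (sigma * t))%:E)%E }.

Lemma dot_seq_cons (x a : R) (v u : seq R) :
  dot_seq (x :: v) (a :: u) = a * x + dot_seq v u.
Proof. by rewrite /dot_seq /= big_cons mulrC. Qed.

(** The rotation takes the linear form with coefficients [a] and [b] to [r] times the first
    coordinate. Since the shear factorisation wants [0 <= c], a negative [a] is absorbed in the sign
    of [r], which therefore need not be a norm. *)
Lemma rotation_align (a b : R) : exists c s r,
  [/\ 0 <= c, c ^+ 2 + s ^+ 2 = 1, a * c + b * s = r & b * c = a * s].
Proof.
wlog a0 : a b / 0 <= a.
  move=> h; have [/h//|a0] := leP 0 a.
  have [|c [s [r [c0 cs acbs bcas]]]] := h (- a) (- b); first by rewrite oppr_ge0 ltW.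
  exists c, s, (- r); split => //; first by rewrite -acbs; ring.
  by apply: oppr_inj; rewrite -!mulNr.
have [a2b2|ab] := eqVneq (a ^+ 2 + b ^+ 2) 0.
  have /eqP := a2b2; rewrite paddr_eq0 ?sqr_ge0// !sqrf_eq0 => /andP[/eqP -> /eqP ->].
  by exists 1, 0, 0; split => //; ring.
pose r := Num.sqrt (a ^+ 2 + b ^+ 2).
have ab0 : 0 <= a ^+ 2 + b ^+ 2 by rewrite addr_ge0 ?sqr_ge0.
have r2 : r ^+ 2 = a ^+ 2 + b ^+ 2 by rewrite sqr_sqrtr.
have r0 : r != 0 by rewrite -sqrf_eq0 r2.
exists (a / r), (b / r), r; split.
- by rewrite divr_ge0// sqrtr_ge0.
- by rewrite !exprMn -mulrDl -r2 -exprMn divff// expr1n.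
- by rewrite !mulrA -mulrDl -!expr2 -r2 expr2 mulfK.
- by rewrite mulrA mulrA [b * a]mulrC.
Qed.

Lemma unit_valued_slice (F : seq R -> R) a :
  unit_valued F -> unit_valued (fun v => F (a :: v)).
Proof. by move=> F01 v; exact: F01. Qed.

Lemma logconcave3_slice n l F G H a b : logconcave3 n.+1 l F G H ->
  logconcave3 n l (fun v => F (a :: v)) (fun v => G (b :: v))
    (fun v => H ((l * a + (1 - l) * b) :: v)).
Proof. by move=> FGH x y xn yn; apply: (FGH (a :: x) (b :: y)); rewrite /= ?xn ?yn. Qed.

Lemma logconcave_slice n F a :
  logconcave_seq n.+1 F -> logconcave_seq n (fun v => F (a :: v)).
Proof.
move=> lF l l01; have := logconcave3_slice _ _ _ _ _ a a (lF l l01).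
by have -> : l * a + (1 - l) * a = a by ring.
Qed.

(** The prepended coordinate may itself vary with the parameter, as it does in the rotated integrand
    where it is [c * t - s * z]. *)
Lemma measurable_family_slice n d (D : measurableType d) (G : D -> seq R -> R)
    d1 (D1 : measurableType d1) (w : D1 -> D) (a : D1 -> R) :
  measurable_fun setT w -> measurable_fun setT a ->
  measurable_family n.+1 _ D G ->
  measurable_family n _ D1 (fun p v => G (w p) (a p :: v)).
Proof.
move=> mw ma mG d' D' w' xs mw' mxs xsn.
apply: (mG _ _ (w \o w') ((a \o w') :: xs)).
- exact: measurableT_comp.
- move=> f [<-|/mxs//]; exact: measurableT_comp.
- by rewrite /= xsn.
Qed.

End disintegration.

(** * Existence of a disintegration, one coordinate at a time *)

Section disintegration_existence.
Context {R : realType}.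
Local Notation gam := (normal_prob (0 : R) 1).

Lemma normal_tonelli_measurable d (D : measurableType d) (H : D * R -> \bar R) :
  measurable_fun setT H -> (forall p, 0 <= H p)%E ->
  measurable_fun setT (fun p => \int[gam]_x H (p, x))%E.
Proof.
by move=> mH H0; exact: (measurable_fun_fubini_tonelli_F (m2 := gam) H mH H0).
Qed.

(** On a point the linear form is [0], whence [sigma = 0], and the dummy Gaussian variable [t]
    integrates to [1]. *)
Lemma disintegration_nil : @disintegration R [::] 0 (fun F _ => F [::]).
Proof.
split => //.
- by move=> F F01 t; exact: F01.
- move=> d D G G01 mG; apply: (mG _ _ fst [::]) => //; exact: measurable_fst.
- by move=> l F G H l01 F01 G01 H01 _ _ _ FGH s t; exact: (FGH [::] [::]).
- move=> F psi F01 mF mpsi psi01 /=; rewrite /dot_seq big_nil.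
  under eq_integral do rewrite mul0r.
  have gT : gam setT = 1%E by exact: probability_setT.
  by rewrite integral_cst//= gT mule1.
Qed.

Section cons.
Context (u : seq R) (a b c s r : R) (E' : (seq R -> R) -> R -> R).
Hypotheses (c0 : 0 <= c) (cs : c ^+ 2 + s ^+ 2 = 1) (acbs : a * c + b * s = r)
  (bcas : b * c = a * s) (dE' : disintegration u b E').

(** The first coordinate [x] and the variable [y] disintegrating the tail are independent Gaussians.
    In the rotated variables [x = c * t - s * z] and [y = s * t + c * z], the form [a * x + b * y]
    equals [r * t], so conditioning on it amounts to fixing [t] and averaging over [z]. *)
Let E (F : seq R -> R) (t : R) : R :=
  gmean (fun z => E' (fun v => F ((c * t - s * z) :: v)) (s * t + c * z)).

Let E'_unit F t : unit_valued F -> 0 <= E' F t <= 1.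
Proof. by move=> F01; exact: (dis_unit _ _ _ dE'). Qed.

Let E_unit F : unit_valued F -> unit_valued (E F).
Proof.
by move=> F01 t; apply: gmean_itv => z; apply: (dis_unit _ _ _ dE') => v; exact: F01.
Qed.

Let measurable_rot d (D : measurableType d) (t z : D -> R) :
  measurable_fun setT t -> measurable_fun setT z ->
  measurable_fun setT (fun p => c * t p - s * z p) /\
  measurable_fun setT (fun p => s * t p + c * z p).
Proof.
move=> mt mz; split.
  by apply: measurable_funB; apply: measurable_funM.
by apply: measurable_funD; apply: measurable_funM.
Qed.

Let measurable_integrand d (D : measurableType d) (G : D -> seq R -> R) :
  (forall p, unit_valued (G p)) -> measurable_family (size u).+1 _ D G ->
  measurable_fun setT (fun q : (D * R) * R =>
    E' (fun v => G q.1.1 ((c * q.1.2 - s * q.2) :: v)) (s * q.1.2 + c * q.2)).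
Proof.
move=> G01 mG.
have m1 : measurable_fun setT (fun q : (D * R) * R => q.1.1).
  by apply: (measurableT_comp measurable_fst); exact: measurable_fst.
have m2 : measurable_fun setT (fun q : (D * R) * R => q.1.2).
  by apply: (measurableT_comp measurable_snd); exact: measurable_fst.
have m3 : measurable_fun setT (fun q : (D * R) * R => q.2) by exact: measurable_snd.
have [mx my] := measurable_rot _ _ _ _ m2 m3.
have := dis_measurable _ _ _ dE' _ _
  (fun q : (D * R) * R => fun v => G q.1.1 ((c * q.1.2 - s * q.2) :: v))
  (fun q => unit_valued_slice _ _ (G01 q.1.1))
  (measurable_family_slice _ _ _ G _ _ _ _ m1 mx mG).
move=> mE'.
have mp : measurable_fun setT (fun q : (D * R) * R => (q, s * q.1.2 + c * q.2)).
  by apply: measurable_fun_pair => //; exact: measurable_id.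
have mc := measurableT_comp mE' mp.
exact: mc.
Qed.

Let E_measurable d (D : measurableType d) (G : D -> seq R -> R) :
  (forall p, unit_valued (G p)) -> measurable_family (size u).+1 _ D G ->
  measurable_fun setT (fun q : D * R => E (G q.1) q.2).
Proof.
move=> G01 mG; apply: measurableT_comp; first exact: fine_measurable.
apply: (normal_tonelli_measurable _ _ (fun q : (D * R) * R =>
    (E' (fun v => G q.1.1 ((c * q.1.2 - s * q.2) :: v)) (s * q.1.2 + c * q.2))%:E)).
  by apply/measurable_EFinP; exact: measurable_integrand.
move=> p; rewrite lee_fin.
by case/andP: (E'_unit _ (s * p.1.2 + c * p.2) (unit_valued_slice _ (c * p.1.2 - s * p.2) (G01 p.1.1))).
Qed.

Let cvx_rot l x y z w :
  c * (l * x + (1 - l) * y) - s * (l * z + (1 - l) * w) =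
    l * (c * x - s * z) + (1 - l) * (c * y - s * w) /\
  s * (l * x + (1 - l) * y) + c * (l * z + (1 - l) * w) =
    l * (s * x + c * z) + (1 - l) * (s * y + c * w).
Proof. by split; ring. Qed.

(** The rotation is linear in [(t, z)], so the induction hypothesis, applied to the slices, gives
    the pointwise Prekopa-Leindler condition in [z]; [gmean_prekopa] then integrates [z] out. *)
Let E_logconcave l F G H : 0 < l < 1 ->
  unit_valued F -> unit_valued G -> unit_valued H ->
  logconcave_seq (size u).+1 F -> logconcave_seq (size u).+1 G ->
  logconcave_seq (size u).+1 H -> logconcave3 (size u).+1 l F G H ->
  forall x y, E F x `^ l * E G y `^ (1 - l) <= E H (l * x + (1 - l) * y).
Proof.
move=> l01 F01 G01 H01 lF lG lH FGH x y.
have key k F1 F2 F3 t1 t2 z1 z2 : 0 < k < 1 ->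
    unit_valued F1 -> unit_valued F2 -> unit_valued F3 ->
    logconcave_seq (size u).+1 F1 -> logconcave_seq (size u).+1 F2 ->
    logconcave_seq (size u).+1 F3 -> logconcave3 (size u).+1 k F1 F2 F3 ->
    E' (fun v => F1 ((c * t1 - s * z1) :: v)) (s * t1 + c * z1) `^ k *
    E' (fun v => F2 ((c * t2 - s * z2) :: v)) (s * t2 + c * z2) `^ (1 - k) <=
    E' (fun v => F3 ((c * (k * t1 + (1 - k) * t2) - s * (k * z1 + (1 - k) * z2)) :: v))
      (s * (k * t1 + (1 - k) * t2) + c * (k * z1 + (1 - k) * z2)).
  move=> k01 F101 F201 F301 l1 l2 l3 F123.
  have [-> ->] := cvx_rot k t1 t2 z1 z2.
  apply: (dis_logconcave _ _ _ dE') => //; try exact: unit_valued_slice;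
    try exact: logconcave_slice.
  exact: logconcave3_slice.
(* [key] with one function at one height [t]: log-concavity of each integrand in [z]. *)
have key1 F1 t : unit_valued F1 -> logconcave_seq (size u).+1 F1 ->
    logconcave (fun z => E' (fun v => F1 ((c * t - s * z) :: v)) (s * t + c * z)).
  move=> F101 l1 k z1 z2 k01.
  have := key k F1 F1 F1 t t z1 z2 k01 F101 F101 F101 l1 l1 l1 (l1 k k01).
  by have -> : k * t + (1 - k) * t = t by ring.
have key2 F1 t : unit_valued F1 -> forall z,
    0 <= E' (fun v => F1 ((c * t - s * z) :: v)) (s * t + c * z) <= 1.
  by move=> F101 z; apply: (dis_unit _ _ _ dE') => v; exact: F101.
apply: gmean_prekopa => //.
- exact: key2.
- exact: key2.
- exact: key2.
- exact: key1.
- exact: key1.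
- exact: key1.
- by move=> z1 z2; exact: key.
Qed.

Let integrand_section F t : unit_valued F -> measurable_seq (size u).+1 F ->
  measurable_fun setT (fun z => E' (fun v => F ((c * t - s * z) :: v)) (s * t + c * z)).
Proof.
move=> F01 mF.
have := measurable_integrand _ R (fun=> F) (fun=> F01) mF => mI.
have mp : measurable_fun setT (fun z : R => ((0 : R, t), z)).
  by apply: measurable_fun_pair => //; exact: measurable_id.
have mc := measurableT_comp mI mp.
exact: mc.
Qed.

(** Negating [t] and [z] together negates both rotated coordinates, and the Gaussian law of [z] is
    symmetric. *)
Let E_opp F : unit_valued F -> measurable_seq (size u).+1 F ->
  forall t, E (fun x => F (map -%R x)) t = E F (- t).
Proof.
move=> F01 mF t; rewrite /E -[RHS]gmean_opp; last 2 first.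
- exact: integrand_section.
- by move=> z; case/andP: (E'_unit _ (s * - t + c * z) (unit_valued_slice _ (c * - t - s * z) F01)).
congr gmean; apply/funext => z /=.
have mslice : measurable_seq (size u) (fun v => F (- (c * t - s * z) :: v)).
  apply: (measurable_family_slice _ _ R (fun=> F) _ _ id (fun=> - (c * t - s * z))) => //.
rewrite (dis_opp _ _ _ dE' _ (unit_valued_slice _ (- (c * t - s * z)) F01) mslice).
by congr (E' _ _); [apply/funext => v; congr (F (_ :: _)); ring | ring].
Qed.

Let E_integral F psi : unit_valued F -> measurable_seq (size u).+1 F ->
  measurable_fun setT psi -> unit_valued psi ->
  gauss_iter (size u).+1 (fun x => (F x * psi (dot_seq x (a :: u)))%:E) =
  (\int[gam]_t (E F t * psi (r * t))%:E)%E.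
Proof.
move=> F01 mF mpsi psi01 /=.
pose W (p : R * R) := (E' (fun v => F (p.1 :: v)) p.2 * psi (a * p.1 + b * p.2))%:E.
have mslice (x : R) : measurable_seq (size u) (fun v => F (x :: v)).
  exact: (measurable_family_slice _ _ R (fun=> F) _ _ id (fun=> x)).
have mslices : measurable_family (size u) _ R (fun x v => F (x :: v)).
  exact: (measurable_family_slice _ _ R (fun=> F) _ _ id id).
(* For a fixed first coordinate [x], the tail is disintegrated against the shifted test function
   [psi (a * x + z)]. *)
transitivity (\int[gam]_x \int[gam]_y W (x, y))%E.
  apply: eq_integral => x _; rewrite /W /=.
  rewrite -(dis_integral _ _ _ dE' (fun v => F (x :: v)) (fun z => psi (a * x + z)))//.
  - congr gauss_iter; apply/funext => v; by rewrite dot_seq_cons.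
  - by apply: measurableT_comp mpsi _; exact: measurable_funD.
have mW : measurable_fun setT W.
  apply/measurable_EFinP; apply: measurable_funM.
    apply: (dis_measurable _ _ _ dE' _ R (fun x v => F (x :: v))) => //.
    by move=> x; exact: unit_valued_slice.
  apply: measurableT_comp mpsi _.
  apply: measurable_funD; apply: measurable_funM => //.
have W0 p : (0 <= W p)%E.
  rewrite lee_fin mulr_ge0//; last by case/andP: (psi01 (a * p.1 + b * p.2)).
  by case/andP: (E'_unit _ p.2 (unit_valued_slice _ p.1 F01)).
rewrite -(normal_integral_rotation c s W c0 cs mW W0).
apply: eq_integral => t _; rewrite /W /=.
(* After the rotation the argument of [psi] is [r * t], free of the inner variable, so this factor
   leaves the inner integral. *)
have -> : (fun y => (E' (fun v => F ((c * t - s * y) :: v)) (s * t + c * y) *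
     psi (a * (c * t - s * y) + b * (s * t + c * y)))%:E) =
   (fun y => (E' (fun v => F ((c * t - s * y) :: v)) (s * t + c * y))%:E *
     (psi (r * t))%:E)%E.
  apply/funext => y; rewrite -EFinM; congr (_ * psi _)%:E.
  transitivity ((a * c + b * s) * t + (b * c - a * s) * y); first by ring.
  by rewrite acbs bcas subrr mul0r addr0.
have key z : 0 <= E' (fun v => F ((c * t - s * z) :: v)) (s * t + c * z) <= 1.
  by apply: (dis_unit _ _ _ dE') => v; exact: F01.
rewrite ge0_integralZr//.
- by rewrite gmeanE// EFinM.
- by apply/measurable_EFinP; exact: integrand_section.
- by move=> z _; rewrite lee_fin; case/andP: (key z).
- by rewrite lee_fin; case/andP: (psi01 (r * t)).
Qed.

Lemma disintegration_cons : disintegration (a :: u) r E.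
Proof.
split => //.
rewrite /E; apply/funext => t; under eq_fun do rewrite (dis_one _ _ _ dE').
exact: gmean_cst.
Qed.

End cons.

Lemma disintegration_exists (u : seq R) : exists sigma E, disintegration u sigma E.
Proof.
elim: u => [|a u [b [E dE]]].
  by exists 0; eexists; exact: disintegration_nil.
have [c [s [r [c0 cs acbs bcas]]]] := rotation_align a b.
by exists r; eexists; exact: (disintegration_cons _ _ _ _ _ _ _ c0 cs acbs bcas dE).
Qed.

End disintegration_existence.

(** * Indicators of convex bodies *)

Section row_measurability.
Context {R : realType}.

(** An open set is a countable union of the boxes with rational centre and radius [k.+1%:R^-1] that
    it contains, and a box is a finite intersection of conditions on single coordinates. *)
Lemma measurable_row_open d (D : measurableType d) n (X : 'I_n -> D -> R)
    (U : set 'rV[R]_n) : open U -> (forall i, measurable_fun setT (X i)) ->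
  measurable [set p | U (\row_i X i p)].
Proof.
move=> oU mX.
pose B (q : 'rV[rat]_n * nat) : set 'rV[R]_n :=
  [set x | forall i, `|ratr (q.1 ord0 i) - x ord0 i| < q.2.+1%:R^-1].
pose F q : set D := if `[< B q `<=` U >] then [set p | B q (\row_i X i p)] else set0.
have -> : [set p | U (\row_i X i p)] = \bigcup_q F q.
  apply/seteqP; split => [p Up|p [q _]]; last first.
    by rewrite /F; case: ifPn => // /asboolP BU; exact: BU.
  have /nbhs_ballP[e /= e0 eU] : nbhs (\row_i X i p) U by exact: open_nbhs_nbhs.
  (* Half of [e] is needed because the box is centred at a rational point near the given one, not at
     the point itself. *)
  pose k := Num.truncn (2 / e).
  have ke : k.+1%:R^-1 < e / 2.
    by rewrite -[e / 2]invrK ltf_pV2 ?posrE ?invr_gt0 ?divr_gt0// invf_div truncnS_gt.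
  have h i : exists q : rat, `|ratr q - X i p| < k.+1%:R^-1.
    have [|q] := @rat_in_itvoo R (X i p - k.+1%:R^-1) (X i p + k.+1%:R^-1).
      by rewrite ltrBlDr -addrA ltrDl addr_gt0// invr_gt0.
    rewrite in_itv/= => /andP[q1 q2]; exists q.
    by rewrite ltr_norml ltrBrDr addrC q1/= ltrBlDl.
  have [f fP] := choice h.
  exists (\row_i f i, k) => //; rewrite /F asboolT => [i|x Bx]/=.
    by rewrite !mxE.
  apply: eU; split => // i j; rewrite (ord1 i) !mxE /ball/=.
  have := Bx j; rewrite /= mxE => Bxj.
  rewrite -(subrKA (ratr (f j))) (le_lt_trans (ler_normD _ _))//.
  by rewrite [ltRHS]splitr ltrD// ?(lt_trans Bxj)// distrC (lt_trans (fP j)).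
apply: countable_bigcupT_measurable => [|q]; first exact: countableP.
rewrite /F; case: ifPn => // _.
have -> : [set p | B q (\row_i X i p)] =
    \bigcap_(i in [set: 'I_n]) (X i @^-1`
      `](ratr (q.1 ord0 i) - q.2.+1%:R^-1), (ratr (q.1 ord0 i) + q.2.+1%:R^-1)[).
  apply/seteqP; split => p /= Bp i.
    by move=> _; have := Bp i; rewrite mxE /= in_itv/= distrC ltr_distl.
  by have := Bp i Logic.I; rewrite mxE /= in_itv/= distrC ltr_distl.
apply: fin_bigcap_measurable => [|i _]; first exact: finite_finset.
by rewrite -[X in measurable X]setTI; apply: mX => //; exact: measurable_itv.
Qed.

Lemma measurable_row_closed d (D : measurableType d) n (X : 'I_n -> D -> R)
    (K : set 'rV[R]_n) : closed K -> (forall i, measurable_fun setT (X i)) ->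
  measurable [set p | K (\row_i X i p)].
Proof.
move=> cK mX; rewrite -[X in measurable X]setCK; apply: measurableC.
by apply: (measurable_row_open _ _ _ X (~` K)) => //; exact: closed_openC.
Qed.

Lemma nth_In T (x0 : T) (xs : seq T) i : (i < size xs)%N -> List.In (nth x0 xs i) xs.
Proof.
elim: xs i => // x xs ih [|i] /=; first by left.
by move=> /ih; right.
Qed.

(** The integrand of [gaussian_measure], named so that slicing can act on sequences. *)
Definition seq_indic d (K : set 'rV[R]_d) (s : seq R) : R := \1_K (\row_(i < d) nth 0 s i).

Lemma seq_indic_unit d (K : set 'rV[R]_d) : unit_valued (seq_indic d K).
Proof. by move=> s; rewrite /seq_indic indicE; case: (_ \in _); rewrite /= ?lexx ?ler01. Qed.

Lemma seq_indic_measurable d (K : set 'rV[R]_d) : closed K ->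
  measurable_seq d (seq_indic d K).
Proof.
move=> cK d' D w xs _ mxs xsd.
have -> : (fun p => seq_indic d K [seq f p | f <- xs]) =
    \1_[set p | K (\row_(i < d) (nth (fun=> 0) xs i) p)] :> (D -> R).
  apply/funext => p; rewrite /seq_indic !indicE; congr (nat_of_bool _)%:R.
  have -> : \row_(i < d) nth 0 [seq f p | f <- xs] i = \row_(i < d) nth (fun=> 0) xs i p.
    by apply/rowP => i; rewrite !mxE (nth_map (fun=> 0))// xsd.
  by apply/idP/idP; rewrite !inE.
apply: measurable_indic; apply: measurable_row_closed => // i.
by apply: mxs; apply: nth_In; rewrite xsd.
Qed.

(** A positive power of [0] is [0], so the left side vanishes unless both points lie in [K]. *)
Lemma seq_indic_logconcave d (K : set 'rV[R]_d) : is_convex K ->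
  logconcave_seq d (seq_indic d K).
Proof.
move=> cK l l01 x y xd yd; rewrite /seq_indic !indicE.
have /andP[l0 l1] := l01.
have [Kx|Kx] := boolP (_ \in _); last first.
  by rewrite powR0 ?gt_eqF// mul0r.
have [Ky|Ky] := boolP (_ \in _); last first.
  by rewrite powR0 ?gt_eqF ?subr_gt0// mulr0.
rewrite mem_set ?powR1 ?mulr1//.
have -> : \row_(i < d) nth 0 (cvx_seq l x y) i =
    l *: \row_(i < d) nth 0 x i + (1 - l) *: \row_(i < d) nth 0 y i.
  apply/rowP => i; rewrite !mxE (nth_map (0, 0)) ?size_zip ?xd ?yd ?minnn//.
  by rewrite nth_zip ?xd ?yd.
by apply: cK; [exact: set_mem|exact: set_mem|rewrite !ltW].
Qed.

Lemma seq_indic_opp d (K : set 'rV[R]_d) s : origin_symmetric K ->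
  seq_indic d K [seq - x | x <- s] = seq_indic d K s.
Proof.
move=> sK; rewrite /seq_indic !indicE.
have -> : \row_(i < d) nth 0 [seq - x | x <- s] i = - \row_(i < d) nth 0 s i.
  apply/rowP => i; rewrite !mxE; have [si|si] := ltnP i (size s).
    by rewrite (nth_map 0).
  by rewrite !nth_default ?oppr0// size_map.
congr (nat_of_bool _)%:R; apply/idP/idP; rewrite !inE => Kx.
  by rewrite sK; exists (- \row_(i < d) nth 0 s i) => //; rewrite opprK.
by rewrite sK; exists (\row_(i < d) nth 0 s i).
Qed.

Lemma dotp_seq d (s : seq R) (u : 'rV[R]_d) : size s = d ->
  dotp (\row_(i < d) nth 0 s i) u = dot_seq s [seq u ord0 i | i <- enum 'I_d].
Proof.
move=> sd; rewrite /dotp /dot_seq (big_nth (0, 0)) size_zip size_map size_enum_ord sd minnn.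
rewrite big_mkord; apply: eq_bigr => i _.
have us : size [seq u ord0 j | j <- enum 'I_d] = d by rewrite size_map size_enum_ord.
rewrite nth_zip ?us// mxE; congr (_ * _).
by rewrite (nth_map i) ?size_enum_ord// nth_ord_enum.
Qed.

End row_measurability.

(** * Monotonicity of the iterated Gaussian integral *)

Section gauss_iter_lemmas.
Local Open Scope ereal_scope.
Context {R : realType}.

Lemma gauss_iter_ge0 n (g : seq R -> \bar R) : (forall s, 0 <= g s) -> 0 <= gauss_iter n g.
Proof.
elim: n g => [|n ih] g g0 /=; first exact: g0.
by apply: integral_ge0 => x _; apply: ih => s; exact: g0.
Qed.

Lemma gauss_iter_le n (g h : seq R -> \bar R) : (forall s, 0 <= g s) ->
  (forall s, size s = n -> g s <= h s) -> gauss_iter n g <= gauss_iter n h.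
Proof.
elim: n g h => [|n ih] g h g0 gh /=; first exact: gh.
apply: ge0_le_integral_nomeas => x; first by apply: gauss_iter_ge0 => s; exact: g0.
by apply: ih => // s sn; apply: gh; rewrite /= sn.
Qed.

Lemma eq_gauss_iter n (g h : seq R -> \bar R) :
  (forall s, size s = n -> g s = h s) -> gauss_iter n g = gauss_iter n h.
Proof.
elim: n g h => [|n ih] g h gh /=; first exact: gh.
by apply: eq_integral => x _; apply: ih => s sn; apply: gh; rewrite /= sn.
Qed.

Lemma gaussian_measure_le d (A B : set 'rV[R]_d) : A `<=` B ->
  gaussian_measure A <= gaussian_measure B.
Proof.
move=> AB; apply: gauss_iter_le => s; first by rewrite lee_fin.
by move=> _; rewrite lee_fin !indicE ler_nat; case: (boolP (_ \in A)) => // /set_mem/AB/mem_set ->.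
Qed.

Lemma gaussian_measure_ge0 d (A : set 'rV[R]_d) : 0 <= gaussian_measure A.
Proof. by apply: gauss_iter_ge0 => s; rewrite lee_fin. Qed.

End gauss_iter_lemmas.

(** * Comparison of averages, and convex hulls with a slab *)

Section gmean_algebra.
Context {R : realType}.
Local Notation gam := (normal_prob (0 : R) 1).

Lemma gmean_le (f g : R -> R) : unit_valued f -> unit_valued g ->
  (forall x, f x <= g x) -> gmean f <= gmean g.
Proof.
move=> f01 g01 fg; rewrite -lee_fin -!gmeanE//.
by apply: ge0_le_integral_nomeas => x; rewrite lee_fin//; case/andP: (f01 x).
Qed.

Lemma gmeanD (f g : R -> R) : measurable_fun setT f -> measurable_fun setT g ->
  unit_valued f -> unit_valued g -> unit_valued (fun x => f x + g x) ->
  gmean (fun x => f x + g x) = gmean f + gmean g.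
Proof.
move=> mf mg f01 g01 fg01; apply: EFin_inj; rewrite EFinD -!gmeanE//.
under eq_integral do rewrite EFinD.
rewrite ge0_integralD//.
- by move=> x _; rewrite lee_fin; case/andP: (f01 x).
- exact/measurable_EFinP.
- by move=> x _; rewrite lee_fin; case/andP: (g01 x).
- exact/measurable_EFinP.
Qed.

Lemma gmeanZ (m : R) (f : R -> R) : 0 <= m <= 1 -> measurable_fun setT f ->
  unit_valued f -> gmean (fun x => m * f x) = m * gmean f.
Proof.
move=> /andP[m0 m1] mf f01; apply: EFin_inj; rewrite EFinM -!gmeanE//; last first.
  by move=> x; have /andP[f0 f1] := f01 x; rewrite mulr_ge0//= mulr_ile1.
under eq_integral do rewrite EFinM.
rewrite ge0_integralZl//.
- exact/measurable_EFinP.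
- by move=> x _; rewrite lee_fin; case/andP: (f01 x).
Qed.

Lemma gmean_finite_support (f : R -> R) (A : set R) : unit_valued f ->
  finite_set A -> (forall x, ~ A x -> f x = 0) -> gmean f = 0.
Proof.
move=> f01 fA fA0; have mA : measurable A.
  have -> : A = \bigcup_(x in A) [set x].
    by apply/seteqP; split => x; [move=> Ax; exists x | case=> y Ay ->].
  by apply: fin_bigcup_measurable => // x _; exact: measurable_set1.
have muA : lebesgue_measure A = 0%E.
  by apply: countable_lebesgue_measure0; exact: finite_set_countable.
have gA : gam A = 0%E.
  apply: null_set_integral => //; apply/measurable_EFinP.
  by apply: measurable_funTS; exact: measurable_normal_pdf.
apply/eqP; rewrite eq_le; apply/andP; split; last by case/andP: (gmean_itv f f01).
rewrite -lee_fin -gmeanE//.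
apply: (@le_trans _ _ (\int[gam]_x (\1_A x)%:E)%E).
  apply: ge0_le_integral_nomeas => x; rewrite lee_fin; have /andP[f0 f1] := f01 x => //.
  rewrite indicE; case: (boolP (x \in A)) => // /negP xA.
  by rewrite fA0// => Ax; apply: xA; exact: mem_set.
by rewrite integral_indic//= setIT gA.
Qed.

Lemma unit_valuedM (f g : R -> R) : unit_valued f -> unit_valued g ->
  unit_valued (fun x => f x * g x).
Proof.
move=> f01 g01 x; have [/andP[f0 f1] /andP[g0 g1]] := (f01 x, g01 x).
by rewrite mulr_ge0//= mulr_ile1.
Qed.

Lemma unit_valued_bool (T : Type) (b : T -> bool) : unit_valued (fun x => (b x)%:R : R).
Proof. by move=> x; case: (b x); rewrite ?lexx ?ler01. Qed.

Lemma measurable_bool_fun d (D : measurableType d) (b : D -> bool) :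
  measurable_fun setT b -> measurable_fun setT (fun x => (b x)%:R : R).
Proof.
move=> mb; have -> : (fun x => (b x)%:R : R) = (fun x => if b x then 1 else 0).
  by apply/funext => x; case: (b x).
exact: measurable_fun_if.
Qed.

(** Here [b] is the inner window, [c] the outer one, and [m] a threshold separating the values of
    [f] on [b] from those off it. Let [x], [y] be the masses of [b] and of [c] minus [b], and [z],
    [w] the integrals of [f] over them. The claim becomes [w * x <= y * z], which follows from
    [w <= m * y] and [m * x <= z]. *)
Lemma gmean_window (m : R) (f : R -> R) (b c : R -> bool) : 0 <= m <= 1 ->
  measurable_fun setT f -> measurable_fun setT b -> measurable_fun setT c ->
  unit_valued f -> (forall x, b x -> c x) ->
  (forall x, b x -> m <= f x) -> (forall x, ~~ b x -> f x <= m) ->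
  gmean (fun x => f x * (~~ c x)%:R) = 0 ->
  gmean f * gmean (fun x => (b x)%:R) <=
  gmean (fun x => (c x)%:R) * gmean (fun x => f x * (b x)%:R).
Proof.
move=> m01 mf mb mc f01 bc fb fnb fc0.
pose e x := c x && ~~ b x.
have me : measurable_fun setT e by apply: measurable_and => //; exact: measurable_neg.
have mnc : measurable_fun setT (fun x => ~~ c x) by exact: measurable_neg.
have mI h : measurable_fun setT h -> measurable_fun setT (fun x : R => (h x : bool)%:R : R).
  exact: measurable_bool_fun.
have mfI h : measurable_fun setT h -> measurable_fun setT (fun x : R => f x * (h x : bool)%:R).
  by move=> mh; apply: measurable_funM => //; exact: mI.
have uI h : unit_valued (fun x : R => f x * (h x : bool)%:R).
  by apply: unit_valuedM => //; exact: unit_valued_bool.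
have uB (h : R -> bool) : unit_valued (fun x => (h x)%:R : R) by exact: unit_valued_bool.
have split_c : gmean (fun x => (c x)%:R) = gmean (fun x => (b x)%:R) + gmean (fun x => (e x)%:R).
  rewrite -gmeanD//; try exact: mI.
    congr gmean; apply/funext => x; rewrite /e.
    by have := bc x; case: (b x); case: (c x) => //=; rewrite ?addr0 ?add0r// => /(_ isT).
  have -> : (fun x => (b x)%:R + (e x)%:R) = (fun x => (c x)%:R) :> (R -> R) by
    apply/funext => x; rewrite /e; have := bc x;
    case: (b x); case: (c x) => //=; rewrite ?addr0 ?add0r// => /(_ isT).
  exact: uB.
have fcE : (fun x => f x * (b x)%:R + f x * (e x)%:R) = (fun x => f x * (c x)%:R).
  apply/funext => x; rewrite /e; have := bc x.
  by case: (b x); case: (c x) => //=; rewrite ?mulr0 ?mulr1 ?addr0 ?add0r// => /(_ isT).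
have fE : f = (fun x => f x * (c x)%:R + f x * (~~ c x)%:R).
  by apply/funext => x; case: (c x); rewrite /= ?mulr0 ?mulr1 ?addr0 ?add0r.
have split_f : gmean f = gmean (fun x => f x * (b x)%:R) + gmean (fun x => f x * (e x)%:R).
  rewrite {1}fE gmeanD//; try exact: mfI; last by rewrite -fE.
  rewrite fc0 addr0 -fcE gmeanD//; try exact: mfI.
  by rewrite fcE; exact: uI.
have lo : m * gmean (fun x => (b x)%:R) <= gmean (fun x => f x * (b x)%:R).
  rewrite -gmeanZ//; last exact: mI.
  apply: gmean_le => //.
    by apply: unit_valuedM => // x.
  by move=> x; case: (boolP (b x)) => [/fb|]; rewrite ?mulr1 ?mulr0.
have hi : gmean (fun x => f x * (e x)%:R) <= m * gmean (fun x => (e x)%:R).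
  rewrite -gmeanZ//; last exact: mI.
  apply: gmean_le => //.
    by apply: unit_valuedM => // x.
  move=> x; rewrite /e; case: (boolP (b x)) => [_|/fnb]; case: (c x);
    by rewrite /= ?mulr1 ?mulr0.
have b0 : 0 <= gmean (fun x => (b x)%:R : R) by case/andP: (gmean_itv _ (uB b)).
have e0 : 0 <= gmean (fun x => (e x)%:R : R) by case/andP: (gmean_itv _ (uB e)).
rewrite split_f split_c.
move: b0 e0 lo hi; set x := gmean _; set y := gmean _; set z := gmean _; set w := gmean _.
move=> b0 e0 lo hi.
rewrite mulrDl mulrDl [z * x]mulrC lerD2l.
apply: (@le_trans _ _ (m * y * x)); first by rewrite ler_wpM2r.
by rewrite -mulrA mulrCA ler_wpM2l.
Qed.

End gmean_algebra.

Section geometry.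
Context {R : realType} {d : nat}.
Implicit Types (x y u : 'rV[R]_d) (K : set 'rV[R]_d).

Lemma dotp_lin x y u (a b : R) : dotp (a *: x + b *: y) u = a * dotp x u + b * dotp y u.
Proof.
rewrite /dotp !mulr_sumr -big_split/=; apply: eq_bigr => i _.
by rewrite !mxE; ring.
Qed.

Lemma dotpN x u : dotp (- x) u = - dotp x u.
Proof. by rewrite /dotp -sumrN; apply: eq_bigr => i _; rewrite !mxE mulNr. Qed.

Lemma dotpNr x u : dotp x (- u) = - dotp x u.
Proof. by rewrite /dotp -sumrN; apply: eq_bigr => i _; rewrite !mxE mulrN. Qed.

Lemma slabN u : slab (- u) = slab u.
Proof. by apply/seteqP; split => x; rewrite /slab/= dotpNr normrN. Qed.

(** The line from [v] through [x] reaches the hyperplane at height [1], which bounds the slab, in a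
    point [z]; then [x] lies between [v] and [z]. The weight [t] solves [r = t * p + (1 - t)]. *)
Lemma convex_slab_between (C : set 'rV[R]_d) u x v :
  is_convex C -> slab u `<=` C -> C v ->
  1 < dotp x u < dotp v u -> C x.
Proof.
move=> cC TC Cv /andP[x1 xv].
set r := dotp x u in x1 xv; set p := dotp v u in xv.
have p1 : 0 < p - 1 by rewrite subr_gt0 (lt_trans x1).
have rp : 0 < p - r by rewrite subr_gt0.
pose t := (r - 1) / (p - 1).
have t0 : 0 <= t by rewrite divr_ge0 ?subr_ge0 ?ltW//; move: p1; rewrite subr_gt0.
have tE : 1 - t = (p - r) / (p - 1) by rewrite /t; field; rewrite gt_eqF.
have t1 : 0 < 1 - t by rewrite tE divr_gt0.
pose z := (1 - t)^-1 *: x + (- (t / (1 - t))) *: v.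
have -> : x = t *: v + (1 - t) *: z.
  rewrite /z scalerDr !scalerA divff ?gt_eqF// scale1r mulrN mulrCA divff ?gt_eqF//.
  by rewrite mulr1 addrCA scaleNr subrr addr0.
apply: cC => //; last by rewrite t0/= -subr_ge0 ltW.
apply: TC; rewrite /slab/= dotp_lin -/r -/p.
have -> : (1 - t)^-1 * r + - (t / (1 - t)) * p = 1.
  by rewrite tE /t; field; rewrite !gt_eqF.
by rewrite normr1.
Qed.

(** Passing to [- v] or [- u] puts [x] and a point of [K] on the same side. The strict inequality
    leaves a positive weight for the point taken in the slab. *)
Lemma conv_hull_slab K u x v : origin_symmetric K -> K v ->
  `|dotp x u| < `|dotp v u| -> conv_hull (K `|` slab u) x.
Proof.
move=> sK Kv xv C [cC KTC].
have TC : slab u `<=` C by move=> y Ty; apply: KTC; right.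
have CK y : K y -> C y by move=> Ky; apply: KTC; left.
have KN y : K y -> K (- y) by move=> Ky; rewrite sK; exists y.
have [w Kw wv] : exists2 w, K w & dotp w u = `|dotp v u|.
  have [v0|v0] := leP 0 (dotp v u); first by exists v; rewrite ?ger0_norm.
  by exists (- v); [exact: KN|rewrite dotpN ltr0_norm].
have [x1|x1] := leP `|dotp x u| 1; first exact: TC.
rewrite -wv in xv.
have [x0|x0] := leP 0 (dotp x u).
  rewrite ger0_norm// in xv x1.
  by apply: (convex_slab_between _ u _ w) => //; [exact: CK|rewrite x1].
rewrite ltr0_norm// in xv x1.
apply: (convex_slab_between _ (- u) _ (- w)) => //.
- by rewrite slabN.
- by apply: CK; exact: KN.
- by rewrite !dotpNr dotpN opprK x1.
Qed.

Lemma dotp_bounded K u : compact K -> exists M, forall x, K x -> `|dotp x u| <= M.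
Proof.
move=> /compact_bounded[M [_ KM]].
(* Boundedness gives an estimate only for constants strictly above [M], hence [M + 1]. *)
exists (\sum_(i < d) (M + 1) * `|u ord0 i|) => x Kx.
rewrite /dotp (le_trans (ler_norm_sum _ _ _))// ler_sum// => i _.
rewrite normrM ler_wpM2r//; apply: le_trans (KM (M + 1) _ _ Kx); last by rewrite ltrDl.
have /mapP[j Hj ->] : `|x ord0 i| \in [seq `|x k.1 k.2| | k : 'I_1 * 'I_d].
  by apply/mapP; exists (ord0, i) => //=; rewrite mem_enum.
by rewrite [leRHS]/Num.norm /= mx_normrE; apply/bigmax_geP; right => /=; exists j.
Qed.

End geometry.

(** A point [t] with [|t| < |s|] is a convex combination of [s] and [- s], where the slice function
    takes equal values, and log-concavity bounds it below at [t] by that value. The cases [s = 0]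
    and [t = s], [t = - s] are set apart to keep the weight defined and strictly inside []0, 1[]. *)
Lemma disintegration_even_decreasing (R : realType) (u : seq R) (sigma : R) E
    (F : seq R -> R) : disintegration u sigma E -> unit_valued F ->
  measurable_seq (size u) F -> logconcave_seq (size u) F ->
  (forall s, F [seq - x | x <- s] = F s) ->
  forall s t, `|t| <= `|s| -> E F s <= E F t.
Proof.
move=> dE F01 mF lF Fopp s t ts.
have Eopp z : E F (- z) = E F z.
  rewrite -(dis_opp _ _ _ dE F F01 mF); congr (E _ z).
  by apply/funext => v; exact: Fopp.
have [s0|s0] := eqVneq s 0.
  by move: ts; rewrite s0 normr0 normr_le0 => /eqP ->.
have [->//|ts1] := eqVneq t s.
have [->|ts2] := eqVneq t (- s); first by rewrite Eopp.
pose l := (1 + t / s) / 2.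
have tl : t = l * s + (1 - l) * - s by rewrite /l; field.
have /andP[tsl tsu] : -1 < t / s < 1.
  rewrite -ltr_norml normrM normfV ltr_pdivrMr ?normr_gt0// mul1r lt_neqAle ts andbT.
  by apply: contraNneq ts1 => /eqP; rewrite eqr_norm2 (negbTE ts2) orbF.
have l01 : 0 < l < 1.
  by rewrite /l; apply/andP; split; [rewrite divr_gt0//|]; lra.
have := dis_logconcave _ _ _ dE l F F F l01 F01 F01 F01 lF lF lF (lF l l01) s (- s).
rewrite -tl Eopp powR_cvx_idem//.
by case/andP: (dis_unit _ _ _ dE F F01 s).
Qed.

Theorem theorem1p2 (R : realType) (d : nat) (K : set 'rV[R]_d) (u : 'rV[R]_d) :
  convex_body K -> origin_symmetric K ->
  (gaussian_measure K * gaussian_measure (slab u)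
    <= gaussian_measure (conv_hull (K `|` slab u)) * gaussian_measure (K `&` slab u))%E.
Proof.
move=> [cK [kK _]] sK.
have [KT|nKT] := pselect (K `<=` slab u).
  rewrite (setIidl KT) muleC lee_wpmul2r ?gaussian_measure_ge0//.
  by apply: gaussian_measure_le => x Tx C [_ KTC]; apply: KTC; right.
have [v Kv v1] : exists2 v, K v & 1 < `|dotp v u|.
  apply: contrapT => h; apply: nKT => x Kx; rewrite /slab/= leNgt; apply/negP => x1.
  by apply: h; exists x.
have clK : closed K by apply: compact_closed => //; exact: norm_hausdorff.
have [M KM] := dotp_bounded K u kK.
pose S := [set `|dotp x u| | x in K].
have ubS : has_ubound S by exists M => _ [x Kx <-]; exact: KM.
pose h := sup S.
have Kh x : K x -> `|dotp x u| <= h by move=> Kx; apply: ub_le_sup => //; exists x.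
have h1 : 1 < h := lt_le_trans v1 (Kh v Kv).
have hK r : r < h -> exists2 w, K w & r < `|dotp w u|.
  move=> rh; have [|_ [w Kw <-] rw] := @sup_gt R S r _ rh; last by exists w.
  by exists `|dotp v u|, v.
pose us := [seq u ord0 i | i <- enum 'I_d].
have usd : size us = d by rewrite size_map size_enum_ord.
have [sg [E dE]] := disintegration_exists us.
pose F := seq_indic d K.
have F01 : unit_valued F by exact: seq_indic_unit.
have mF : measurable_seq (size us) F by rewrite usd; exact: seq_indic_measurable.
have one01 : unit_valued (fun _ : seq R => 1 : R) by move=> x; rewrite lexx ler01.
have mone : measurable_seq (size us) (fun=> 1 : R).
  by move=> d' D w xs _ _ _; exact: measurable_cst.
pose f := E F.
have f01 : unit_valued f := dis_unit _ _ _ dE F F01.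
have mf : measurable_fun setT f.
  have mp : measurable_fun setT (fun t : R => (0 : R, t)) by exact: measurable_fun_pair.
  have := measurableT_comp (dis_measurable _ _ _ dE _ R (fun=> F) (fun=> F01) mF) mp.
  by [].
have fmono : forall s t, `|t| <= `|s| -> f s <= f t.
  apply: (disintegration_even_decreasing _ _ _ _ _ dE) => //.
    by rewrite usd; exact: seq_indic_logconcave.
  by move=> s; exact: seq_indic_opp.
(* The bridge to one dimension: [G] restricted by a condition on the height becomes a weighted mean
   on the line. [G] is taken to be [F] or the constant [1]. *)
have slice (G : seq R -> R) (p : R -> bool) : unit_valued G ->
    measurable_seq (size us) G -> measurable_fun setT p ->
    gauss_iter d (fun s => (G s * (p (dot_seq s us))%:R)%:E) =
    (gmean (fun t => E G t * (p (sg * t))%:R))%:E.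
  move=> G01 mG mp; rewrite -usd.
  rewrite (dis_integral _ _ _ dE G (fun r => (p r)%:R))//.
  - rewrite gmeanE// => t.
    by apply: (unit_valuedM (E G) (fun t => (p (sg * t))%:R)) => //;
      [exact: (dis_unit _ _ _ dE) | exact: unit_valued_bool].
  - exact: measurable_bool_fun.
  - exact: unit_valued_bool.
have mnorm : measurable_fun setT (fun r : R => `|r|) by exact: normr_measurable.
have mle1 : measurable_fun setT (fun r : R => `|r| <= 1) by exact: measurable_fun_ler.
have mlth : measurable_fun setT (fun r : R => `|r| < h) by exact: measurable_fun_ltr.
have mgeh : measurable_fun setT (fun r : R => ~~ (`|r| < h)) by exact: measurable_neg.
have meqh : measurable_fun setT (fun r : R => `|r| == h) by exact: measurable_fun_eqr.
pose b t := `|sg * t| <= 1.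
pose c t := `|sg * t| < h.
have msg : measurable_fun setT (fun t : R => sg * t) by exact: measurable_funM.
have gK : gaussian_measure K = (gmean f)%:E.
  have := slice F (fun=> true) F01 mF (@measurable_cst _ _ _ _ _ _).
  have -> : (fun t => E F t * true%:R) = f by apply/funext => t; rewrite mulr1.
  by move=> <-; apply: eq_gauss_iter => s _; rewrite mulr1.
have gT : gaussian_measure (slab u) = (gmean (fun t => (b t)%:R))%:E.
  have := slice _ _ one01 mone mle1; rewrite (dis_one _ _ _ dE).
  have -> : (fun t => 1 * (`|sg * t| <= 1)%R%:R) = (fun t => (b t)%:R) :> (R -> R).
    by apply/funext => t; rewrite mul1r.
  move=> <-; apply: eq_gauss_iter => s sd; rewrite -(dotp_seq _ _ _ sd) mul1r indicE.
  by congr ((nat_of_bool _)%:R%:E); apply/idP/idP; rewrite inE.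
have gKT : gaussian_measure (K `&` slab u) = (gmean (fun t => f t * (b t)%:R))%:E.
  rewrite -(slice _ _ F01 mF mle1).
  apply: eq_gauss_iter => s sd; rewrite -(dotp_seq _ _ _ sd) indicI /F /seq_indic.
  congr ((_ * (nat_of_bool _)%:R)%:E).
  by apply/idP/idP; rewrite inE.
have gC : ((gmean (fun t => (c t)%:R))%:E <= gaussian_measure (conv_hull (K `|` slab u)))%E.
  have := slice _ _ one01 mone mlth; rewrite (dis_one _ _ _ dE).
  have -> : (fun t => 1 * (`|sg * t| < h)%R%:R) = (fun t => (c t)%:R) :> (R -> R).
    by apply/funext => t; rewrite mul1r.
  move=> <-; apply: gauss_iter_le => s; first by rewrite mul1r lee_fin.
  move=> sd; rewrite -(dotp_seq _ _ _ sd) mul1r lee_fin indicE ler_nat.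
  have [xh|//] := boolP (_ < h); rewrite mem_set//.
  by have [w Kw xw] := hK _ xh; exact: conv_hull_slab Kw xw.
(* Pointwise, [f] is not known to vanish at heights beyond [h]. The integral is therefore lifted
   back to the whole space, where [K] beyond the open slab lies in the two hyperplanes at height [h]
   in absolute value; these descend to at most two values of [t], a null set. *)
have fc0 : gmean (fun t => f t * (~~ c t)%:R) = 0.
  have nc01 : unit_valued (fun t => f t * (~~ c t)%:R).
    by apply: unit_valuedM => //; exact: unit_valued_bool.
  apply/eqP; rewrite eq_le; apply/andP; split; last by case/andP: (gmean_itv _ nc01).
  rewrite -lee_fin -(slice _ _ F01 mF mgeh).
  have : gmean (fun t => (`|sg * t| == h)%:R) = 0 :> R.
    apply: (gmean_finite_support _ [set h / sg; - (h / sg)]).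
    - exact: unit_valued_bool.
    - by [].
    move=> t /= nt; case: eqP => // th; exfalso; apply: nt.
    have sg0 : sg != 0.
      by apply: contraTneq h1 => sg0; rewrite -th sg0 mul0r normr0 ltr10.
    have h0 : 0 <= h by rewrite (le_trans ler01) ?ltW.
    have [t0|t0] := leP 0 (sg * t); [left|right].
      by rewrite -th ger0_norm// mulrAC divff ?mul1r.
    by rewrite -th ltr0_norm// mulNr opprK mulrAC divff ?mul1r.
  move=> N0; have := slice _ _ one01 mone meqh; rewrite (dis_one _ _ _ dE).
  have -> : (fun t => 1 * (`|sg * t| == h)%:R) = (fun t => (`|sg * t| == h)%:R) :> (R -> R).
    by apply/funext => t; rewrite mul1r.
  rewrite N0 => <-; apply: gauss_iter_le => s.
    by rewrite lee_fin mulr_ge0//; case/andP: (F01 s).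
  move=> sd; rewrite -(dotp_seq _ _ _ sd) mul1r lee_fin /F /seq_indic indicE.
  have [Kx|_] := boolP (_ \in K); last by rewrite mul0r.
  by rewrite mul1r ler_nat -leNgt eq_le (Kh _ (set_mem Kx)); case: (h <= _).
(* For nonzero [sg] the inner window is [|t| <= |sg^-1|], so by monotonicity the value of [f] at its
   edge separates inside from outside. For [sg = 0] the window is the whole line and [0] serves. *)
have [m [m01 fb fnb]] : exists m, [/\ 0 <= m <= 1, forall t, b t -> m <= f t &
    forall t, ~~ b t -> f t <= m].
  have [sg0|sg0] := eqVneq sg 0.
    exists 0; split; rewrite ?lexx ?ler01// => t; first by case/andP: (f01 t).
    by rewrite /b sg0 mul0r normr0 ler01.
  exists (f sg^-1); split => // t.
    rewrite /b normrM => bt; apply: fmono.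
    by rewrite normfV -[leRHS]mul1r ler_pdivlMr ?normr_gt0// mulrC.
  rewrite /b normrM -ltNge => bt; apply: fmono.
  by rewrite normfV -[leLHS]mul1r ler_pdivrMr ?normr_gt0// mulrC ltW.
have mb : measurable_fun setT b by exact: measurableT_comp mle1 msg.
have mc : measurable_fun setT c by exact: measurableT_comp mlth msg.
have := gmean_window m f b c m01 mf mb mc f01
  (fun t bt => le_lt_trans bt h1) fb fnb fc0.
rewrite gK gT gKT -lee_fin EFinM => /le_trans; apply.
rewrite EFinM lee_wpmul2r// lee_fin.
have fb01 : unit_valued (fun t => f t * (b t)%:R).
  by apply: unit_valuedM => //; exact: unit_valued_bool.
by case/andP: (gmean_itv _ fb01).
Qed.
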